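(* Let $G$ be a finite-dimensional Lie group, let $V,V'$ be finite-dimensional real vector spaces, and let $\Phi:G\to\mathrm{Aut}(V)$ and $\Phi':G\to\mathrm{Aut}(V')$ be equivalent representations. Then their prolongations $\widetilde{\Phi}:TG\to\mathrm{Aut}(TV)$ and $\widetilde{\Phi'}:TG\to\mathrm{Aut}(TV')$ are equivalent representations of $TG$.
   Context: Representations are finite-dimensional and real: a representation of a Lie group $G$ on $V$ is a Lie group homomorphism $\Phi:G\to \mathrm{Aut}(V)$, where $\mathrm{Aut}(V)$ is the Lie group of linear automorphisms of $V$. Two representations $\Phi,\Phi'$ of $G$ on $V,V'$ are equivalent if there is a linear isomorphism $A:V\to V'$ with $A(\Phi(a)(p))=\Phi'(a)(A(p))$ for all $a\in G$, $p\in V$. $T$ denotes the tangent bundle of a manifold and the tangent map (differential) of a smooth map. $TG$ is a Lie group with multiplication $T\mu:TG\times TG\to TG$, where $\mu$ is the multiplication of $G$ and $T(G\times G)$ is identified with $TG\times TG$. Vector space structure on $TV$ ($\dim V=n$): for $X\in T_xV$, $Y\in T_yV$, $\lambda\in\mathbb{R}$, set $X\oplus Y=(T\tau_y)X+(T\tau_x)Y\in T_{x+y}V$ and $\lambda\bullet X=(T\sigma_\lambda)X\in T_{\lambda x}V$, where $\tau_x:V\to V$ is translation by $x$ and $\sigma_\lambda:V\to V$ is multiplication by $\lambda$. With these operations $TV$ is a real vector space of dimension $2n$. Bases: fix a basis $\{\alpha_1,\dots,\alpha_n\}$ of $V$ with associated linear coordinate functions $x_1,\dots,x_n$ on $V$,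 and let $e_1,\dots,e_n$ be the standard basis of $\mathbb{R}^n$. Let $\psi:TV\to V\times\mathbb{R}^n$, $\psi(v)=(p,\sum_i v[x_i]e_i)$ for $v\in T_pV$. Put $\widetilde{\alpha}_i=\psi^{-1}(\alpha_i,0)$, $\widetilde{y}_i=\psi^{-1}(0,e_i)$; then $(\widetilde\alpha_1,\dots,\widetilde\alpha_n,\widetilde y_1,\dots,\widetilde y_n)$ is a basis of $TV$. Maps: $Z:\mathrm{Aut}(V)\to GL(n,\mathbb{R})$ sends an automorphism to its matrix with respect to $(\alpha_i)$, and $\breve Z:\mathrm{Aut}(TV)\to GL(2n,\mathbb{R})$ sends an automorphism to its matrix with respect to $(\widetilde\alpha_1,\dots,\widetilde\alpha_n,\widetilde y_1,\dots,\widetilde y_n)$. Every element of $T(GL(n,\mathbb{R}))$ at $a\in GL(n,\mathbb{R})$ is uniquely of the form $[a,B]:=TR_a(B)$ with $B\in \mathrm{Lie}(GL(n,\mathbb{R}))=T_eGL(n,\mathbb{R})$ and $R_a(y)=ya$. The one-to-one Lie group homomorphism $J_n:T(GL(n,\mathbb{R}))\to GL(2n,\mathbb{R})$ is $J_n([a,B])=\begin{pmatrix} a & 0\\ Ba & a\end{pmatrix}$. The prolongation of $\Phi$ to $TG$ is the representation $\widetilde{\Phi}=\breve{Z}^{-1}\circ J_n\circ TZ\circ T\Phi:TG\to\mathrm{Aut}(TV)$; similarly for $\Phi'$ and $V'$. *)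

(* Defs.v *)
From HB Require Import structures.
From mathcomp Require Import all_boot all_order fingroup perm all_algebra.
From mathcomp Require Import all_classical all_reals all_analysis.
Set Implicit Arguments.
Unset Strict Implicit.
Unset Printing Implicit Defensive.
Import Order.TTheory GRing.Theory Num.Theory numFieldNormedType.Exports.
Import passmx.
Local Open Scope classical_set_scope.
Local Open Scope ring_scope.

Section Calculus.
Variable R : realType.

(* For k > 0: F is Frechet differentiable on U and all its directional
   derivatives are C^(k-1) on U. *)
Fixpoint Ck (k m n : nat) (U : set 'rV[R]_m) (F : 'rV[R]_m -> 'rV[R]_n) : Prop :=
  if k is k'.+1 then
    (forall x, U x -> differentiable F x) /\
    (forall v, Ck k' U (fun x => 'D_v F x))
  else forall x, U x -> {for x, continuous F}.

Definition Cinf m n (U : set 'rV[R]_m) (F : 'rV[R]_m -> 'rV[R]_n) : Prop :=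
  forall k, Ck k U F.

Lemma near_eq_differentiable (V W : normedModType R) (f g : V -> W) (x : V) :
  (\near x, f x = g x) -> differentiable f x -> differentiable g x.
Proof.
move=> fg df.
have -> : g = f + (g - f) by apply/funext => y; rewrite !fctE addrC subrK.
apply: differentiableD => //.
set h := g - f.
have h0 : h x = 0 by rewrite /h !fctE (nbhs_singleton fg) subrr.
have hE : h \o shift x = cst (h x) + (\0 : {linear V -> W}) +o_ 0 id.
  apply/eqaddoP => /= e e0.
  move: fg; rewrite (near_shift 0) /= subr0 => fg.
  near=> y; rewrite !fctE /= h0 addr0 subr0.
  have -> : h (y + x) = 0.
    have : f (y + x) = g (y + x).
      by near: y.
    by rewrite /h !fctE => ->; rewrite subrr.
  by rewrite normr0 mulr_ge0 // ltW.
have c0 : continuous (\0 : V -> W) by move=> y; exact: cst_continuous.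
have dE : 'd h x = \0 :> (V -> W) by apply: (@diff_unique _ V W h \0).
by apply/diff_locallyP; rewrite dE; split.
Unshelve. all: by end_near. Qed.

Lemma lin_differentiable m (W : normedModType R) (L : {linear 'rV[R]_m -> W})
  (x : 'rV[R]_m) : differentiable L x.
Proof.
have -> : (L : 'rV[R]_m -> W) =
    \sum_(i < m) (fun y : 'rV[R]_m => y 0 i *: L (delta_mx 0 i)).
  apply/funext => y; rewrite [in LHS](row_sum_delta y) linear_sum fct_sumE.
  by apply: eq_bigr => i _; rewrite linearZ.
apply: differentiable_sum => i; apply: differentiableZl.
exact: differentiable_coord.
Qed.

Lemma lin_continuous m (W : normedModType R) (L : {linear 'rV[R]_m -> W}) :
  continuous L.
Proof. by move=> x; apply: differentiable_continuous; apply: lin_differentiable. Qed.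

Lemma lin_derive m (W : normedModType R) (L : {linear 'rV[R]_m -> W})
  (x v : 'rV[R]_m) : 'D_v L x = L v.
Proof.
by rewrite deriveE ?diff_lin //; [exact: lin_continuous|exact: lin_differentiable].
Qed.

Lemma derive_lin_comp (V : normedModType R) m (W : normedModType R)
  (L : {linear 'rV[R]_m -> W}) (f : V -> 'rV[R]_m) (x v : V) :
  differentiable f x -> 'D_v (L \o f) x = L ('D_v f x).
Proof.
move=> df; have dL := lin_differentiable L (f x).
rewrite !deriveE //; last exact: differentiable_comp.
by rewrite diff_comp //= diff_lin //; exact: lin_continuous.
Qed.

Lemma Ck_ext k m n U (F G : 'rV[R]_m -> 'rV[R]_n) : open U ->
  (forall x, U x -> F x = G x) -> Ck k U F -> Ck k U G.
Proof.
move=> oU; elim: k F G => [|k IH] F G FG /=.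
  move=> cF x Ux; have nU : nbhs x U by exact: open_nbhs_nbhs.
  have FGx : \near x, F x = G x by apply: filterS nU => y; exact: FG.
  have /= h := cF _ Ux; change (F y @[y --> x] --> F x) in h.
  change (G y @[y --> x] --> G x); rewrite -(FG _ Ux).
  exact: (cvg_trans (@near_eq_cvg _ _ (nbhs x) _ F G FGx) h).
case=> dF cF; split=> [x Ux|v].
  apply: near_eq_differentiable (dF x Ux).
  by apply: filterS (open_nbhs_nbhs (conj oU Ux)) => y; exact: FG.
apply: (IH (fun x => 'D_v F x)) => // x Ux.
apply: near_eq_derive.
by apply: filterS (open_nbhs_nbhs (conj oU Ux)) => y; exact: FG.
Qed.

Lemma Ck_sub k m n (U U' : set 'rV[R]_m) (F : 'rV[R]_m -> 'rV[R]_n) :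
  U' `<=` U -> Ck k U F -> Ck k U' F.
Proof.
move=> sU; elim: k F => [|k IH] F /=; first by move=> cF x /sU; exact: cF.
by case=> dF cF; split=> [x /sU|v]; [exact: dF|apply: IH; exact: cF].
Qed.

Lemma Ck_leS k m n U (F : 'rV[R]_m -> 'rV[R]_n) : Ck k.+1 U F -> Ck k U F.
Proof.
elim: k F => [|k IH] F [dF cF].
  by move=> x /dF; exact: differentiable_continuous.
by split=> // v; apply: IH; exact: cF.
Qed.

Lemma Ck_cst k m n U (c : 'rV[R]_n) : Ck k U (fun _ : 'rV[R]_m => c).
Proof.
elim: k c => [|k IH] c /=; first by move=> x _; exact: cst_continuous.
split=> [x _|v]; first exact: differentiable_cst.
rewrite [X in Ck _ _ X](_ : _ = fun _ => 0) //.
by apply/funext => x; exact: derive_cst.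
Qed.

Lemma Ck_lin k m n U (L : {linear 'rV[R]_m -> 'rV[R]_n}) : Ck k U L.
Proof.
case: k => [|k] /=; first by move=> x _; exact: lin_continuous.
split=> [x _|v]; first exact: lin_differentiable.
rewrite [X in Ck _ _ X](_ : _ = fun _ => L v); first exact: Ck_cst.
by apply/funext => x; rewrite lin_derive.
Qed.

Lemma Ck_add k m n U (F G : 'rV[R]_m -> 'rV[R]_n) : open U ->
  Ck k U F -> Ck k U G -> Ck k U (fun x => F x + G x).
Proof.
move=> oU; elim: k F G => [|k IH] F G /=.
  by move=> cF cG x Ux; apply: continuousD; [exact: cF|exact: cG].
move=> [dF cF] [dG cG]; split=> [x Ux|v].
  by apply: differentiableD; [exact: dF|exact: dG].
apply: (@Ck_ext _ _ _ _ (fun x => 'D_v F x + 'D_v G x)) => //.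
  by move=> x Ux; rewrite -deriveD //; apply: diff_derivable; [exact: dF|exact: dG].
exact: IH.
Qed.

Lemma Ck_sum k m n p U (F : 'I_p -> 'rV[R]_m -> 'rV[R]_n) : open U ->
  (forall i, Ck k U (F i)) -> Ck k U (fun x => \sum_(i < p) F i x).
Proof.
move=> oU; elim: p F => [|p IH] F cF.
  by apply: (Ck_ext oU _ (@Ck_cst k m n U 0)) => x _; rewrite big_ord0.
apply: (Ck_ext oU _ (Ck_add oU (IH _ (fun i => cF (widen_ord (leqnSn p) i)))
  (cF ord_max))) => x _.
by rewrite big_ord_recr.
Qed.

Lemma differentiable_scal m n p (h : 'rV[R]_m -> 'rV[R]_p)
  (G : 'rV[R]_m -> 'rV[R]_n) i x : differentiable h x -> differentiable G x ->
  differentiable (fun y => h y 0 i *: G y) x.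
Proof.
move=> dh dG.
have -> : (fun y => h y 0 i *: G y) =
   \sum_(j < n) (fun y => (h y 0 i * G y 0 j) *: delta_mx 0 j).
  apply/funext => y; rewrite fct_sumE [in LHS](row_sum_delta (G y)) scaler_sumr.
  by apply: eq_bigr => j _; rewrite scalerA.
apply: differentiable_sum => j; apply: differentiableZl.
have dhi : differentiable (fun y => h y 0 i) x.
  exact: (differentiable_comp dh (differentiable_coord _ 0 i)).
have dGj : differentiable (fun y => G y 0 j) x.
  exact: (differentiable_comp dG (differentiable_coord _ 0 j)).
exact: differentiableM.
Qed.

Lemma derive_coord (V : normedModType R) m n (M : V -> 'M[R]_(m, n)) x v i j :
  differentiable M x -> 'D_v (fun y => M y i j) x = ('D_v M x) i j.
Proof. by move=> dM; rewrite derive_mx ?mxE //; exact: diff_derivable. Qed.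

Lemma derive_scal m n p (h : 'rV[R]_m -> 'rV[R]_p)
  (G : 'rV[R]_m -> 'rV[R]_n) i x v : differentiable h x -> differentiable G x ->
  'D_v (fun y => h y 0 i *: G y) x =
  ('D_v h x) 0 i *: G x + h x 0 i *: 'D_v G x.
Proof.
move=> dh dG; apply/rowP => j.
rewrite -derive_coord; last exact: differentiable_scal.
have dhi : differentiable (fun y => h y 0 i) x.
  exact: (differentiable_comp dh (differentiable_coord _ 0 i)).
have dGj : differentiable (fun y => G y 0 j) x.
  exact: (differentiable_comp dG (differentiable_coord _ 0 j)).
rewrite [X in 'D_v X x](_ : _ = (fun y => h y 0 i) * (fun y => G y 0 j)).
  rewrite deriveM; [|exact: diff_derivable|exact: diff_derivable].
  rewrite (derive_coord v 0 i dh) (derive_coord v 0 j dG) !mxE addrC.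
  by congr (_ + _); exact: mulrC.
by apply/funext => y; rewrite !mxE.
Qed.

Lemma Ck_scal k m n p U (h : 'rV[R]_m -> 'rV[R]_p) (G : 'rV[R]_m -> 'rV[R]_n) i :
  open U -> Ck k U h -> Ck k U G -> Ck k U (fun x => h x 0 i *: G x).
Proof.
move=> oU; elim: k h G => [|k IH] h G.
  move=> /= ch cG x Ux; apply: continuousZ; last exact: cG.
  exact: (continuous_comp (ch x Ux) (@coord_continuous _ _ _ 0 i (h x))).
move=> ch cG; case: (ch) (cG) => [dh h'] [dG G'].
split=> [x Ux|v]; first by apply: differentiable_scal; [exact: dh|exact: dG].
apply: (@Ck_ext _ _ _ _
  (fun x => ('D_v h x) 0 i *: G x + h x 0 i *: 'D_v G x)) => //.
  by move=> x Ux; rewrite (derive_scal _ _ (dh _ Ux) (dG _ Ux)).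
apply: Ck_add => //.
  by apply: (IH (fun x => 'D_v h x)); [exact: h'|exact: Ck_leS cG].
by apply: (IH h (fun x => 'D_v G x)); [exact: Ck_leS ch|exact: G'].
Qed.

Lemma derive_chain m n p (F : 'rV[R]_m -> 'rV[R]_n) (G : 'rV[R]_n -> 'rV[R]_p)
  x v : differentiable F x -> differentiable G (F x) ->
  'D_v (G \o F) x = \sum_i ('D_v F x) 0 i *: 'D_(delta_mx 0 i) G (F x).
Proof.
move=> dF dG; rewrite !deriveE //; last exact: differentiable_comp.
rewrite diff_comp //= {1}(row_sum_delta ('d F x v)) linear_sum.
by apply: eq_bigr => i _; rewrite linearZ /= [in RHS]deriveE.
Qed.

Lemma Ck_comp k m n p (U : set 'rV[R]_m) (W : set 'rV[R]_n)
  (F : 'rV[R]_m -> 'rV[R]_n) (G : 'rV[R]_n -> 'rV[R]_p) : open U ->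
  (forall x, U x -> W (F x)) -> Ck k U F -> Ck k W G -> Ck k U (G \o F).
Proof.
move=> oU UW; elim: k p G => [|k IH] p G.
  by move=> /= cF cG x Ux; apply: continuous_comp; [exact: cF|apply: cG; exact: UW].
move=> cF cG; case: (cF) (cG) => [dF F'] [dG G'].
split=> [x Ux|v].
  by apply: differentiable_comp; [exact: dF|apply: dG; exact: UW].
apply: (@Ck_ext _ _ _ _
  (fun x => \sum_i ('D_v F x) 0 i *: 'D_(delta_mx 0 i) G (F x))) => //.
  by move=> x Ux; rewrite (derive_chain _ (dF _ Ux) (dG _ (UW _ Ux))).
apply: Ck_sum => // i; apply: Ck_scal => //; first exact: F'.
apply: (IH _ (fun y => 'D_(delta_mx 0 i) G y)); [exact: Ck_leS cF|exact: G'].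
Qed.

Lemma Ck_row_mx k m n p U (F : 'rV[R]_m -> 'rV[R]_n) (G : 'rV[R]_m -> 'rV[R]_p) :
  open U -> Ck k U F -> Ck k U G -> Ck k U (fun x => row_mx (F x) (G x)).
Proof.
move=> oU cF cG.
pose A : {linear 'rV[R]_n -> 'rV[R]_(n + p)} := mulmxr (row_mx 1%:M 0).
pose B : {linear 'rV[R]_p -> 'rV[R]_(n + p)} := mulmxr (row_mx 0 1%:M).
have cA : Ck k U (A \o F) by apply: (@Ck_comp _ _ _ _ _ setT) => //; exact: Ck_lin.
have cB : Ck k U (B \o G) by apply: (@Ck_comp _ _ _ _ _ setT) => //; exact: Ck_lin.
apply: (Ck_ext oU _ (Ck_add oU cA cB)) => x _ /=.
by rewrite !mul_mx_row !mulmx1 !mulmx0 add_row_mx addr0 add0r.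
Qed.

Lemma open_preimage_in (S T : topologicalType) (U : set S) (F : S -> T) (O : set T) :
  open U -> open O -> (forall x, U x -> {for x, continuous F}) ->
  open (U `&` F @^-1` O).
Proof.
move=> oU oO cF; rewrite openE => x [Ux Ox].
apply: filterI; first exact: open_nbhs_nbhs.
by apply: (cF x Ux); exact: open_nbhs_nbhs.
Qed.

End Calculus.

Section Manifolds.
Variable R : realType.

Record chart (M : Type) (n : nat) := Chart {
  cdom : set M;
  cmap :> M -> 'rV[R]_n }.

Record smooth_structure := SmoothStructure {
  carrier :> Type;
  sdim : nat;
  atlas : set (chart carrier sdim) }.

(* Open sets of the topology defined by the atlas. *)
Definition mopen (M : smooth_structure) (A : set M) : Prop :=
  forall phi, atlas phi -> open (phi @` (A `&` cdom phi)).

(* F represents the transition map psi o phi^-1. *)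
Definition compatible (M : Type) n (phi psi : chart M n) : Prop :=
  open (phi @` (cdom phi `&` cdom psi)) /\
  exists F : 'rV[R]_n -> 'rV[R]_n,
    Cinf (phi @` (cdom phi `&` cdom psi)) F /\
    forall q, cdom phi q -> cdom psi q -> psi q = F (phi q).

Record is_manifold (M : smooth_structure) : Prop := IsManifold {
  chart_inj : forall phi : chart M (sdim M), atlas phi ->
    {in cdom phi &, injective phi};
  chart_open : forall phi : chart M (sdim M), atlas phi ->
    open (phi @` cdom phi);
  charts_cover : forall p : M, exists2 phi : chart M (sdim M),
    atlas phi & cdom phi p;
  charts_compatible : forall phi psi : chart M (sdim M),
    atlas phi -> atlas psi -> compatible phi psi;
  manifold_hausdorff : forall p q : M, p <> q -> exists A B : set M,
    [/\ mopen A, mopen B, A p, B q & A `&` B = set0];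
  (* equivalent to second countability, charts being open in R^n *)
  manifold_countable : exists2 C : set (chart M (sdim M)), countable C &
    C `<=` atlas (s := M) /\ forall p : M, exists2 phi, C phi & cdom phi p }.

(* The local expression psi o f o phi^-1 agrees on the neighbourhood W of
   phi p with a function F which is C^oo on W. *)
Definition smooth_at (M N : smooth_structure) (f : M -> N) (p : M) : Prop :=
  exists (phi : chart M (sdim M)) (psi : chart N (sdim N))
         (W : set 'rV[R]_(sdim M)) (F : 'rV[R]_(sdim M) -> 'rV[R]_(sdim N)),
  [/\ [/\ atlas phi, cdom phi p, atlas psi & cdom psi (f p)],
      [/\ open W, W (phi p) & W `<=` phi @` cdom phi],
      Cinf W F &
      forall q, cdom phi q -> W (phi q) ->
        cdom psi (f q) /\ psi (f q) = F (phi q)].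

Definition smooth (M N : smooth_structure) (f : M -> N) : Prop :=
  forall p, smooth_at f p.

Lemma smooth_at_comp (M N P : smooth_structure) (f : M -> N) (g : N -> P) p :
  is_manifold N -> smooth_at f p -> smooth_at g (f p) ->
  smooth_at (fun x => g (f x)) p.
Proof.
move=> mN [phi [psi [W [F [[aphi phip apsi psifp] [oW Wp WU] cF FE]]]]].
move=> [psi' [chi [W' [F' [[apsi' psi'fp achi chip] [oW' W'p W'U] cF' F'E]]]]].
have [oO [T [cT TE]]] := charts_compatible mN apsi apsi'.
set O := psi @` _ in oO cT.
have cTc x : O x -> {for x, continuous T} by exact: (cT 0%N).
have cFc x : W x -> {for x, continuous F} by exact: (cF 0%N).
have oOW : open (O `&` T @^-1` W') by exact: open_preimage_in.
pose W'' := W `&` F @^-1` (O `&` T @^-1` W').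
have oW'' : open W'' by exact: open_preimage_in.
have [_ Fp] := FE _ phip Wp.
exists phi, chi, W'', (F' \o (T \o F)); split=> //.
- split=> // [|x [/WU//]].
  split=> //=; rewrite -Fp; split; first by exists (f p).
  by rewrite /= -TE.
- move=> k; apply: (@Ck_comp _ _ _ _ _ _ W') => //.
  + by move=> x [_ []].
  + apply: (@Ck_comp _ _ _ _ _ _ O) => //.
    * by move=> x [_ []].
    * by apply: (Ck_sub _ (cF k)) => x [].
- move=> q qphi [Wq [Oq W'q]].
  have [psifq Fq] := FE _ qphi Wq.
  case: Oq => q' [psiq' psi'q'] eq'; rewrite -Fq in eq' W'q *.
  have q'E : q' = f q by apply: (chart_inj mN apsi) => //; rewrite inE.
  subst q'; rewrite /= -TE // in W'q; rewrite /= -Fq -TE //.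
  exact: (F'E (f q)).
Qed.

Definition prod_chart (M N : Type) m n (phi : chart M m) (psi : chart N n) :
    chart (M * N) (m + n) :=
  Chart [set p | cdom phi p.1 /\ cdom psi p.2]
        (fun p => row_mx (phi p.1) (psi p.2)).

Definition prod_structure (M N : smooth_structure) : smooth_structure :=
  @SmoothStructure (M * N)%type (sdim M + sdim N)
    [set c | exists phi psi,
       [/\ atlas phi, atlas psi & c = prod_chart phi psi]].

Definition global_structure (M : Type) n (f : M -> 'rV[R]_n) : smooth_structure :=
  SmoothStructure [set Chart setT f].

Lemma global_manifold (M : Type) n (f : M -> 'rV[R]_n) :
  injective f -> open (range f) -> is_manifold (global_structure f).
Proof.
move=> injf openf; split => /=.
- by move=> _ -> x y _ _ /injf.
- by move=> _ ->.
- by move=> p; exists (Chart setT f).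
- move=> _ _ -> ->; split; rewrite /= setIid //.
  exists id; split => // k.
  exact: (Ck_lin k _ (idfun : {linear 'rV[R]_n -> 'rV[R]_n})).
- move=> p q pq.
  have fpq : f p != f q by apply/eqP => /injf.
  have := @norm_hausdorff R 'rV[R]_n; rewrite open_hausdorff.
  move=> /(_ _ _ fpq) [[A B] /= [+ +] [oA oB AB0]]; rewrite !inE => Ap Bq.
  have om O : open O -> mopen (M := global_structure f) (f @^-1` O).
    move=> oO _ ->; rewrite /= setIT.
    rewrite [X in open X](_ : _ = range f `&` O); first exact: openI.
    apply/seteqP; split=> [_ [x Ox <-]|_ [[x _ <-] Ox]]; first by split=> //; exists x.
    by exists x.
  exists (f @^-1` A), (f @^-1` B); split=> //; [exact: om|exact: om|].
  by rewrite -preimage_setI (eqP AB0) preimage_set0.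
- exists [set Chart setT f]; first exact: countable1.
  by split=> // p; exists (Chart setT f).
Qed.

Lemma global_smooth_at (M N : Type) m n (f : M -> 'rV[R]_m) (g : N -> 'rV[R]_n)
  (h : M -> N) (F : 'rV[R]_m -> 'rV[R]_n) (p : M) :
  open (range f) -> Cinf (range f) F -> (forall q, g (h q) = F (f q)) ->
  @smooth_at (global_structure f) (global_structure g) h p.
Proof.
move=> of_ cF FE; exists (Chart setT f), (Chart setT g), (range f), F.
by split=> //; split=> //; exists p.
Qed.

Lemma smooth_at_pair (K : Type) n (c : K -> 'rV[R]_n) (M N : smooth_structure)
    (f : K -> M) (g : K -> N) (p : K) :
  smooth_at (M := global_structure c) f p ->
  smooth_at (M := global_structure c) g p ->
  smooth_at (M := global_structure c) (N := prod_structure M N)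
    (fun x => (f x, g x)) p.
Proof.
move=> [phi [psi [W [F [[aphi phip apsi psifp] [oW Wp WU] cF FE]]]]].
move=> [phi' [psi' [W' [F' [[aphi' phip' apsi' psifp'] [oW' Wp' WU'] cF' FE']]]]].
move: aphi aphi'; rewrite /= => ? ?; subst phi phi'.
exists (Chart setT c), (prod_chart psi psi'), (W `&` W'),
  (fun x => row_mx (F x) (F' x)); split.
- by split=> //; exists psi, psi'.
- by split=> //; [exact: openI|move=> x [/WU]].
- move=> k; apply: Ck_row_mx; first exact: openI.
  + by apply: (Ck_sub _ (cF k)) => x [].
  + by apply: (Ck_sub _ (cF' k)) => x [].
- move=> q _ /= [Wq W'q].
  by have [? <-] := FE _ I Wq; have [? <-] := FE' _ I W'q.
Qed.

(* A finite-dimensional vector space with its standard smooth structure, given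
   by linear coordinates; the choice of the basis is immaterial. *)
Definition crd (V : vectType R) : V -> 'rV[R]_(\dim {:V}) := rVof (vbasis {:V}).
Definition uncrd (V : vectType R) : 'rV[R]_(\dim {:V}) -> V := vecof (vbasis {:V}).

HB.instance Definition _ (V : vectType R) := GRing.Linear.on (@crd V).
HB.instance Definition _ (V : vectType R) := GRing.Linear.on (@uncrd V).

Lemma crdK (V : vectType R) : cancel (@crd V) (@uncrd V).
Proof. exact: rVofK (vbasisP _). Qed.

Lemma uncrdK (V : vectType R) : cancel (@uncrd V) (@crd V).
Proof. exact: vecofK (vbasisP _). Qed.

Definition vect_structure (V : vectType R) : smooth_structure :=
  global_structure (@crd V).

Definition real_line : smooth_structure := vect_structure R^o.

(* The subset P of V, meant to be open (see open_manifold). *)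
Definition open_structure (V : vectType R) (P : pred V) : smooth_structure :=
  global_structure (fun x : {v : V | P v} => crd (val x)).

Lemma range_crd (V : vectType R) : range (@crd V) = setT.
Proof. by apply/seteqP; split=> // x _; exists (uncrd x); rewrite ?uncrdK. Qed.

Lemma range_open (V : vectType R) (P : pred V) :
  range (fun x : {v : V | P v} => crd (val x)) = [set x | P (uncrd x)].
Proof.
apply/seteqP; split=> [_ [x _ <-]|x Px] /=; first by rewrite crdK; exact: valP.
by exists (exist _ (uncrd x) Px) => //=; rewrite uncrdK.
Qed.

Lemma vect_manifold (V : vectType R) : is_manifold (vect_structure V).
Proof.
apply: global_manifold; first exact: can_inj (@crdK V).
by rewrite range_crd; exact: openT.
Qed.

Lemma open_manifold (V : vectType R) (P : pred V) :
  open [set x | P (@uncrd V x)] -> is_manifold (open_structure P).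
Proof.
move=> oP; apply: global_manifold; last by rewrite range_open.
by move=> x y /(can_inj (@crdK V)) /val_inj.
Qed.

Lemma Cinf_affine m n (U : set 'rV[R]_m) (L : {linear 'rV[R]_m -> 'rV[R]_n}) c :
  open U -> Cinf U (fun x => L x + c).
Proof. by move=> oU k; apply: Ck_add => //; [exact: Ck_lin|exact: Ck_cst]. Qed.

Lemma affine_smooth (V W : vectType R) (L : {linear V -> W}) (c : W) :
  @smooth (vect_structure V) (vect_structure W) (fun x => L x + c).
Proof.
move=> p; have oT : open (range (@crd V)) by rewrite range_crd; exact: openT.
apply: (global_smooth_at _ oT
  (@Cinf_affine _ _ _ (@crd W \o L \o @uncrd V) (crd c) oT)) => q /=.
by rewrite crdK linearD.
Qed.

Lemma open_linear_smooth (V W : vectType R) (P : pred V) (Q : pred W)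
    (h : {v : V | P v} -> {w : W | Q w}) (L : {linear V -> W}) :
  open [set x | P (@uncrd V x)] -> (forall q, val (h q) = L (val q)) ->
  @smooth (open_structure P) (open_structure Q) h.
Proof.
rewrite -range_open => oT hE p.
apply: (global_smooth_at _ oT
  (@Cinf_affine _ _ _ (@crd W \o L \o @uncrd V) 0 oT)) => q /=.
by rewrite crdK addr0 hE.
Qed.

End Manifolds.

Section ProductManifold.
Variable R : realType.
Implicit Types M N : smooth_structure R.

Lemma row_mx_image M N m n (phi : chart R M m) (psi : chart R N n)
    (A : set M) (B : set N) :
  prod_chart phi psi @` [set p | A p.1 /\ B p.2] =
  (lsubmx : 'rV[R]_(m + n) -> 'rV[R]_m) @^-1` (phi @` A) `&`
  (rsubmx : 'rV[R]_(m + n) -> 'rV[R]_n) @^-1` (psi @` B).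
Proof.
apply/seteqP; split=> [_ [[x y] /= [Ax By] <-]|z [[x Ax xz] [y By yz]]].
  by split; rewrite /= ?row_mxKl ?row_mxKr; [exists x|exists y].
by exists (x, y) => //=; rewrite xz yz hsubmxK.
Qed.

Lemma open_sub_preimage m n (A : set 'rV[R]_m) (B : set 'rV[R]_n) :
  open A -> open B -> open ((lsubmx : 'rV[R]_(m + n) -> 'rV[R]_m) @^-1` A `&`
  (rsubmx : 'rV[R]_(m + n) -> 'rV[R]_n) @^-1` B).
Proof.
move=> oA oB; apply: openI; apply: open_comp => // x _.
  exact: (@lin_continuous R _ _ (@lsubmx R 1 m n : {linear _ -> _})).
exact: (@lin_continuous R _ _ (@rsubmx R 1 m n : {linear _ -> _})).
Qed.

Lemma prod_manifold M N : is_manifold M -> is_manifold N ->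
  is_manifold (prod_structure M N).
Proof.
move=> mM mN.
have cE (phi phi' : chart R M (sdim M)) (psi psi' : chart R N (sdim N)) :
    cdom (prod_chart phi psi) `&` cdom (prod_chart phi' psi') =
    [set p | (cdom phi `&` cdom phi') p.1 /\ (cdom psi `&` cdom psi') p.2].
  by apply/seteqP; split=> p /= [[? ?] [? ?]].
split.
- move=> _ [phi [psi [aphi apsi ->]]] [x y] [x' y'].
  rewrite !inE /= => -[xphi ypsi] [x'phi y'psi] /eq_row_mx [].
  move=> /(chart_inj mM aphi) -> //; rewrite ?inE //.
  by move=> /(chart_inj mN apsi) -> //; rewrite ?inE.
- move=> _ [phi [psi [aphi apsi ->]]].
  rewrite row_mx_image; apply: open_sub_preimage.
    exact: chart_open.
  exact: chart_open.
- move=> [x y]; have [phi aphi xphi] := charts_cover mM x.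
  have [psi apsi ypsi] := charts_cover mN y.
  by exists (prod_chart phi psi) => //; exists phi, psi.
- move=> _ _ [phi [psi [aphi apsi ->]]] [phi' [psi' [aphi' apsi' ->]]].
  have [oO [F [cF FE]]] := charts_compatible mM aphi aphi'.
  have [oO' [F' [cF' FE']]] := charts_compatible mN apsi apsi'.
  split; rewrite cE row_mx_image; first exact: open_sub_preimage.
  have oU := open_sub_preimage oO oO'.
  exists (fun z => row_mx (F (lsubmx z)) (F' (rsubmx z))); split.
    move=> k; apply: Ck_row_mx => //.
      apply: (Ck_comp oU _ (Ck_lin k _ (@lsubmx R 1 _ _ : {linear _ -> _})) (cF k)).
      by move=> x [].
    apply: (Ck_comp oU _ (Ck_lin k _ (@rsubmx R 1 _ _ : {linear _ -> _})) (cF' k)).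
    by move=> x [].
  by move=> [x y] /= [? ?] [? ?]; rewrite row_mxKl row_mxKr FE ?FE'.
- have open1 (A : set M) : mopen A ->
      mopen (M := prod_structure M N) [set p | A p.1].
    move=> oA _ [phi [psi [aphi apsi ->]]].
    rewrite (_ : _ `&` _ = [set p | (A `&` cdom phi) p.1 /\ cdom psi p.2]).
      rewrite row_mx_image; apply: open_sub_preimage; first exact: oA.
      exact: chart_open.
    by apply/seteqP; split=> p /= => [[? []]|[[]]].
  have open2 (B : set N) : mopen B ->
      mopen (M := prod_structure M N) [set p | B p.2].
    move=> oB _ [phi [psi [aphi apsi ->]]].
    rewrite (_ : _ `&` _ = [set p | cdom phi p.1 /\ (B `&` cdom psi) p.2]).
      rewrite row_mx_image; apply: open_sub_preimage; last exact: oB.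
      exact: chart_open.
    by apply/seteqP; split=> p /= => [[? []]|[? []]].
  move=> [x y] [x' y'] xy.
  have [xx'|xx'] := pselect (x = x').
    have yy' : y <> y' by move=> yy'; apply: xy; rewrite xx' yy'.
    have [A [B [oA oB Ay By AB]]] := manifold_hausdorff mN yy'.
    exists [set p | A p.2], [set p | B p.2]; split=> //; [exact: open2|exact: open2|].
    apply/seteqP; split=> // p [Ap Bp].
    by have : (A `&` B) p.2 by []; rewrite AB.
  have [A [B [oA oB Ay By AB]]] := manifold_hausdorff mM xx'.
  exists [set p | A p.1], [set p | B p.1]; split=> //; [exact: open1|exact: open1|].
  apply/seteqP; split=> // p [Ap Bp].
  by have : (A `&` B) p.1 by []; rewrite AB.
- have [C cC [CM CE]] := manifold_countable mM.
  have [D cD [DN DE]] := manifold_countable mN.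
  exists [set prod_chart c.1 c.2 | c in C `*` D].
    apply: (card_le_trans (card_image_le _ _)).
    exact: countableX.
  split.
    by move=> _ [[phi psi] [/= Cphi Dpsi] <-]; exists phi, psi; split=> //; [exact: CM|exact: DN].
  move=> [x y]; have [phi Cphi xphi] := CE x; have [psi Dpsi ypsi] := DE y.
  by exists (prod_chart phi psi) => //; exists (phi, psi).
Qed.

End ProductManifold.

Section Tangent.
Variable R : realType.
Implicit Types M N P : smooth_structure R.

Definition smooth_fun_at M (g : M -> R) (p : M) : Prop :=
  smooth_at (N := real_line R) g p.

Definition smooth_curve M (c : R -> M) : Prop :=
  smooth_at (M := real_line R) c 0.

(* The velocity at time 0 of a curve c, as an operator on the functions which
   are smooth near c 0. The value on other functions is irrelevant; it is set
   to 0 so that equal tangent vectors are Leibniz equal. *)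
Definition velocity M (c : R -> M) (g : M -> R) : R :=
  if `[< smooth_fun_at g (c 0) >] then derive1 (fun t => g (c t)) 0 else 0.

Record tangent M := Tangent {
  tbase : M;
  tact : (M -> R) -> R;
  tangentP : exists c : R -> M,
    [/\ smooth_curve c, c 0 = tbase & tact = velocity c] }.

Lemma tangent_eq M (X Y : tangent M) :
  tbase X = tbase Y -> tact X = tact Y -> X = Y.
Proof.
case: X Y => [p v hv] [q w hw] /= pq vw; subst q w.
by congr Tangent; exact: Prop_irrelevance.
Qed.

Definition curve_tangent M (c : R -> M) (hc : smooth_curve c) : tangent M :=
  @Tangent M (c 0) (velocity c) (ex_intro _ c (And3 hc erefl erefl)).

Definition tmap_act M N (f : M -> N) (X : tangent M) (g : N -> R) : R :=
  if `[< smooth_fun_at g (f (tbase X)) >] then tact X (fun q => g (f q)) else 0.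

Lemma tmap_subproof M N (mM : is_manifold M) (mN : is_manifold N) (f : M -> N)
    (sf : smooth f) (X : tangent M) : exists c : R -> N,
  [/\ smooth_curve c, c 0 = f (tbase X) & tmap_act f X = velocity c].
Proof.
have [c [sc c0 cE]] := tangentP X; exists (fun t => f (c t)); split.
- exact: (smooth_at_comp mM sc (sf _)).
- by rewrite c0.
- apply/funext => g; rewrite /tmap_act /velocity c0 cE.
  case: asboolP => // sg; rewrite /velocity.
  by case: asboolP => //; rewrite c0; case; exact: (smooth_at_comp mN (sf _) sg).
Qed.

(* (Tf)(X)[g] = X[g o f] *)
Definition tmap M N (mM : is_manifold M) (mN : is_manifold N) (f : M -> N)
    (sf : smooth f) (X : tangent M) : tangent N :=
  Tangent (tmap_subproof mM mN sf X).

(* The chart of TM induced by a chart (x_i) of M is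
   X |-> (x_i(p), X[x_i]), p being the base point of X. *)
Definition tangent_chart M (phi : chart R M (sdim M)) :
    chart R (tangent M) (sdim M + sdim M) :=
  Chart [set X : tangent M | cdom phi (tbase X)]
        (fun X => row_mx (phi (tbase X))
                         (\row_i tact X (fun q => phi q 0 i))).

Definition tangent_structure M : smooth_structure R :=
  @SmoothStructure R (tangent M) (sdim M + sdim M)
    [set c | exists2 phi, atlas phi & c = tangent_chart phi].

Definition tcurve M (X : tangent M) : R -> M := projT1 (cid (tangentP X)).

Lemma tcurveP M (X : tangent M) :
  [/\ smooth_curve (tcurve X), tcurve X 0 = tbase X & tact X = velocity (tcurve X)].
Proof. exact: projT2 (cid (tangentP X)). Qed.

Lemma tcurve_smooth M (X : tangent M) : smooth_curve (tcurve X).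
Proof. by case: (tcurveP X). Qed.

(* The identification TM x TN = T(M x N): the velocities of two curves c and d
   are sent to the velocity of (c, d); this does not depend on the choice of
   the curves. *)
Definition tpair M N (X : tangent M) (Y : tangent N) :
    tangent (prod_structure M N) :=
  curve_tangent (M := prod_structure M N)
    (smooth_at_pair (tcurve_smooth X) (tcurve_smooth Y)).

End Tangent.

Section TangentVectorSpace.
Variables (R : realType) (V : vectType R).
Local Notation mV := (vect_manifold V).

Definition tvect := tangent (vect_structure V).

Definition translation (x : V) : vect_structure V -> vect_structure V :=
  fun q => q + x.
Definition homothety (a : R) : vect_structure V -> vect_structure V :=
  fun q => a *: q.

Lemma translation_smooth x : smooth (translation x).
Proof. exact: (affine_smooth (idfun : {linear V -> V}) x). Qed.

Lemma homothety_smooth a : smooth (homothety a).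
Proof.
have -> : homothety a = fun q => (a *: (idfun : V -> V)) q + 0.
  by apply/funext => q; rewrite addr0.
exact: (affine_smooth (a \*: (idfun : {linear V -> V}))).
Qed.

Local Notation rl := (real_line R).
Local Notation crdR := (@crd R R^o).
Local Notation uncrdR := (@uncrd R R^o).

Definition dir_derive (g : V -> R) (p w : V) : R := 'D_(crd w) (g \o @uncrd R V) (crd p).

Lemma vect_smooth_funP (g : V -> R) (p : V) :
  smooth_fun_at (M := vect_structure V) g p ->
  differentiable (g \o @uncrd R V) (crd p).
Proof.
move=> [phi [psi [W [F [[aphi phip apsi psifp] [oW Wp WU] cF FE]]]]].
move: aphi apsi; rewrite /= => ? ?; subst phi psi.
apply: (@near_eq_differentiable _ _ _ ((uncrdR : _ -> R) \o F)).
  apply: filterS (open_nbhs_nbhs (conj oW Wp)) => x Wx /=.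
  have := FE (uncrd x) I; rewrite /= uncrdK => /(_ Wx) [_ <-].
  by rewrite crdK.
apply: differentiable_comp; first by case: (cF 1%N) => dF _; exact: dF.
exact: (lin_differentiable (@uncrd R R^o : {linear _ -> R^o})).
Qed.

Lemma vect_smooth_curveP (c : R -> V) : smooth_curve (M := vect_structure V) c ->
  differentiable (fun t => crd (c t)) 0.
Proof.
move=> [phi [psi [W [F [[aphi phip apsi psifp] [oW Wp WU] cF FE]]]]].
move: aphi apsi; rewrite /= => ? ?; subst phi psi.
have crdRE : (crdR : R -> _) = fun t => t *: crdR 1.
  apply/funext => t; rewrite -linearZ; congr crd; exact: (esym (mulr1 _)).
have dcrdR : differentiable (crdR : R -> _) 0.
  by rewrite crdRE; exact: differentiableZl.
apply: (@near_eq_differentiable _ _ _ (F \o (crdR : R -> _))).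
  have ccrd := differentiable_continuous dcrdR.
  have nW : \forall t \near nbhs (0 : R), W (crdR t).
    exact: (ccrd _ (open_nbhs_nbhs (conj oW Wp))).
  by apply: filterS nW => t Wt /=; have [_ <-] := FE t I Wt.
apply: differentiable_comp => //.
by case: (cF 1%N) => dF _; exact: dF.
Qed.

Lemma dir_derive_linear (g : V -> R) p : smooth_fun_at (M := vect_structure V) g p ->
  forall a u v, dir_derive g p (a *: u + v) = a * dir_derive g p u + dir_derive g p v.
Proof.
move=> sg a u v; have dg := vect_smooth_funP sg.
by rewrite /dir_derive !deriveE // linearP linearP.
Qed.

Lemma crd_smooth (W : vectType R) (L : {linear V -> W}) (c : W) i p :
  smooth_fun_at (M := vect_structure V) (fun q => crd (L q + c) 0 i) p.
Proof.
pose e x : R^o := crd (L x) 0 i.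
have e_lin : linear e by move=> a x y; rewrite /e !linearP !mxE.
pose eM := GRing.isLinear.Build _ _ _ _ e e_lin.
pose eL : {linear V -> R^o} := HB.pack e eM.
rewrite (_ : (fun q => _) = fun q => eL q + crd c 0 i).
  exact: (affine_smooth eL (crd c 0 i : R^o)).
by apply/funext => q; rewrite linearD [LHS]mxE.
Qed.

Lemma dir_derive_crd (W : vectType R) (L : {linear V -> W}) (c : W) i p w :
  dir_derive (fun q => crd (L q + c) 0 i) p w = crd (L w) 0 i.
Proof.
pose M : {linear 'rV[R]_(\dim {:V}) -> 'rV[R]_(\dim {:W})} :=
  @crd R W \o L \o @uncrd R V.
have dM x : differentiable (M : _ -> _) x by exact: lin_differentiable.
have dMc x : differentiable ((M : _ -> 'rV[R]_(\dim {:W})) + cst (crd c)) x.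
  exact: differentiableD.
rewrite /dir_derive (_ : _ \o _ =
    fun x => ((M : _ -> 'rV[R]_(\dim {:W})) + cst (crd c)) x 0 i); last first.
  by apply/funext => x; rewrite /= linearD.
rewrite derive_coord // deriveD //; last exact: diff_derivable.
by rewrite derive_cst addr0 lin_derive /M /= crdK.
Qed.

(* the vector of V corresponding to a tangent vector *)
Definition tvec (X : tvect) : V := uncrd (\row_i tact X (fun q => crd q 0 i)).

Lemma tactE (X : tvect) g : tact X g =
  if `[< smooth_fun_at (M := vect_structure V) g (tbase X) >]
  then dir_derive g (tbase X) (tvec X) else 0.
Proof.
have [c [sc c0 cE]] := tangentP X.
have dc := vect_smooth_curveP sc.
pose w := derive1 (fun t => crd (c t)) 0.
have E h : smooth_fun_at (M := vect_structure V) h (tbase X) ->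
    tact X h = dir_derive h (tbase X) (uncrd w).
  move=> sh; rewrite cE /velocity c0 asboolT //.
  have dh := vect_smooth_funP sh; rewrite -c0 in dh.
  rewrite (_ : (fun t => h (c t)) = (h \o @uncrd R V) \o (fun t => crd (c t))).
    rewrite derive1E' ?diff_comp //; last exact: differentiable_comp.
    by rewrite /dir_derive uncrdK -c0 deriveE // /w derive1E'.
  by apply/funext => t /=; rewrite crdK.
have -> : tvec X = uncrd w.
  congr uncrd; apply/rowP => i; rewrite mxE.
  have eqh : (fun q : V => crd q 0 i) =
      (fun q => crd ((idfun : {linear V -> V}) q + 0) 0 i).
    by apply/funext => q; rewrite addr0.
  rewrite eqh E; last exact: crd_smooth.
  by rewrite dir_derive_crd /= uncrdK.
case: asboolP => [/E//|nsg].
by rewrite cE /velocity c0 asboolF.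
Qed.

Lemma tvec_eq (X Y : tvect) : tbase X = tbase Y -> tvec X = tvec Y -> X = Y.
Proof.
move=> bE vE; apply: tangent_eq => //.
by apply/funext => g; rewrite !tactE bE vE.
Qed.

Lemma tvec_act (X : tvect) i : tact X (fun q => crd q 0 i) = crd (tvec X) 0 i.
Proof. by rewrite /tvec uncrdK mxE. Qed.

Definition line (p w : V) : R -> vect_structure V := fun t => p + t *: w.

Lemma line_smooth p w : smooth_curve (line p w).
Proof.
pose e (t : R^o) := t *: w.
have e_lin : linear e by move=> a x y; rewrite /e scalerDl scalerA.
pose eM := GRing.isLinear.Build _ _ _ _ e e_lin.
pose eL : {linear R^o -> V} := HB.pack e eM.
rewrite /smooth_curve (_ : line p w = fun t => eL t + p).
  exact: (affine_smooth eL).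
by apply/funext => t; rewrite addrC.
Qed.

(* the velocity of t |-> p + t w *)
Definition tvmk (p w : V) : tvect := curve_tangent (line_smooth p w).

Lemma tbase_tvmk p w : tbase (tvmk p w) = p.
Proof. by rewrite /= /line scale0r addr0. Qed.

Lemma crd0E i (q : V) :
  crd q 0 i = crd ((idfun : {linear V -> V}) q + 0) 0 i.
Proof. by rewrite addr0. Qed.

Lemma tvec_tvmk p w : tvec (tvmk p w) = w.
Proof.
rewrite -[RHS]crdK; congr uncrd; apply/rowP => i; rewrite mxE.
rewrite /= /velocity asboolT; last first.
  rewrite (_ : (fun q => _) =
    fun q => crd ((idfun : {linear V -> V}) q + 0) 0 i).
    exact: crd_smooth.
  by apply/funext => q; rewrite -crd0E.
rewrite (_ : (fun t => _) = fun t => crd p 0 i + t * crd w 0 i).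
  by rewrite derive1E deriveD // derive_cst add0r -derive1E derive1Mr // derive1_id mul1r.
by apply/funext => t; rewrite /line linearD linearZ !mxE.
Qed.

Lemma tvec_tmap (L : {linear V -> V}) (c : V) (f : vect_structure V -> vect_structure V)
  (sf : smooth f) X : (forall q, f q = L q + c) ->
  tvec (tmap mV mV sf X) = L (tvec X).
Proof.
move=> fE; rewrite -[RHS]crdK; congr uncrd; apply/rowP => i; rewrite mxE.
rewrite /= /tmap_act asboolT; last first.
  rewrite (_ : (fun q => _) =
    fun q => crd ((idfun : {linear V -> V}) q + 0) 0 i).
    exact: crd_smooth.
  by apply/funext => q; rewrite -crd0E.
rewrite tactE (_ : (fun q => _) = fun q => crd (L q + c) 0 i); last first.
  by apply/funext => q; rewrite fE.
by rewrite asboolT ?dir_derive_crd //; exact: crd_smooth.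
Qed.

Lemma tadd_subproof (X Y : tvect) : exists c : R -> vect_structure V,
  [/\ smooth_curve c, c 0 = (tbase X : V) + (tbase Y : V) &
  (fun g => tact (tmap mV mV (translation_smooth (tbase Y)) X) g +
            tact (tmap mV mV (translation_smooth (tbase X)) Y) g) = velocity c].
Proof.
exists (line ((tbase X : V) + (tbase Y : V)) (tvec X + tvec Y)); split.
- exact: line_smooth.
- exact: tbase_tvmk.
- apply/funext => g.
  rewrite -[RHS]/(tact (tvmk _ _) g) !tactE tbase_tvmk tvec_tvmk.
  rewrite !(@tvec_tmap (idfun : {linear V -> V}) _ _ _ _ (fun=> erefl)) /=.
  rewrite /translation [in X in _ + X]addrC.
  case: asboolP => [sg|_]; last by rewrite addr0.
  by have := dir_derive_linear sg 1 (tvec X) (tvec Y); rewrite scale1r mul1r => ->.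
Qed.

(* X (+) Y = T(tau_y) X + T(tau_x) Y, for X in T_x V and Y in T_y V; the sum on
   the right is that of the tangent space at x + y. *)
Definition tadd (X Y : tvect) : tvect := Tangent (tadd_subproof X Y).

Definition tscale (a : R) (X : tvect) : tvect :=
  tmap mV mV (homothety_smooth a) X.

Definition tzero : tvect := tvmk 0 0.
Definition topp (X : tvect) : tvect := tscale (- 1) X.

Lemma tvec_tadd X Y : tvec (tadd X Y) = tvec X + tvec Y.
Proof.
rewrite -[RHS]crdK; congr uncrd; apply/rowP => i; rewrite mxE /= -!/(tact _ _).
rewrite -[tmap_act _ X _]/(tact (tmap mV mV (translation_smooth (tbase Y)) X) _).
rewrite -[tmap_act _ Y _]/(tact (tmap mV mV (translation_smooth (tbase X)) Y) _).
rewrite !tvec_act !(@tvec_tmap (idfun : {linear V -> V}) _ _ _ _ (fun=> erefl)).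
by rewrite linearD !mxE.
Qed.

Lemma tvec_tscale a X : tvec (tscale a X) = a *: tvec X.
Proof.
rewrite (@tvec_tmap (a \*: (idfun : {linear V -> V})) 0) // => q.
by rewrite addr0.
Qed.

HB.instance Definition _ := gen_eqMixin tvect.
HB.instance Definition _ := gen_choiceMixin tvect.

Fact taddA : associative tadd.
Proof. by move=> X Y Z; apply: tvec_eq; rewrite ?tvec_tadd /= addrA. Qed.

Fact taddC : commutative tadd.
Proof. by move=> X Y; apply: tvec_eq; rewrite ?tvec_tadd /= addrC. Qed.

Fact tadd0 : left_id tzero tadd.
Proof.
move=> X; apply: tvec_eq; rewrite ?tvec_tadd.
  by rewrite -[LHS]/(tbase tzero + (tbase X : V)) tbase_tvmk add0r.
by rewrite tvec_tvmk add0r.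
Qed.

Fact taddN : left_inverse tzero topp tadd.
Proof.
move=> X; apply: tvec_eq; rewrite ?tvec_tadd.
  by rewrite tbase_tvmk /= /homothety scaleN1r addNr.
by rewrite tvec_tscale tvec_tvmk scaleN1r addNr.
Qed.

HB.instance Definition _ :=
  GRing.isZmodule.Build tvect taddA taddC tadd0 taddN.

Fact tscaleA a b X : tscale a (tscale b X) = tscale (a * b) X.
Proof. by apply: tvec_eq; rewrite ?tvec_tscale /= /homothety scalerA. Qed.

Fact tscale1 : left_id 1 tscale.
Proof. by move=> X; apply: tvec_eq; rewrite ?tvec_tscale /= /homothety scale1r. Qed.

Fact tscaleDr : right_distributive tscale +%R.
Proof.
move=> a X Y; apply: tvec_eq; first by rewrite /= /homothety scalerDr.
by rewrite tvec_tscale !tvec_tadd !tvec_tscale scalerDr.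
Qed.

Fact tscaleDl X : {morph tscale^~ X : a b / a + b}.
Proof.
move=> a b; apply: tvec_eq; first by rewrite /= /homothety scalerDl.
by rewrite tvec_tscale tvec_tadd !tvec_tscale scalerDl.
Qed.

HB.instance Definition _ :=
  GRing.Zmodule_isLmodule.Build R tvect tscaleA tscale1 tscaleDr tscaleDl.

Fact tvect_vect_iso : Vector.axiom (\dim {:V} + \dim {:V}) tvect.
Proof.
exists (fun X : tvect => row_mx (crd (tbase X : V)) (crd (tvec X))).
  move=> a X Y; rewrite tvec_tadd tvec_tscale.
  rewrite -[tbase _]/(a *: (tbase X : V) + (tbase Y : V)).
  by rewrite !linearP scale_row_mx add_row_mx.
exists (fun z => tvmk (uncrd (lsubmx z)) (uncrd (rsubmx z))) => [X|z].
  by apply: tvec_eq; rewrite ?tbase_tvmk ?tvec_tvmk ?row_mxKl ?row_mxKr crdK.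
by rewrite tbase_tvmk tvec_tvmk !uncrdK hsubmxK.
Qed.

HB.instance Definition _ := Lmodule_hasFinDim.Build R tvect tvect_vect_iso.

Section Bases.
Variables (n : nat) (alpha : n.-tuple V).

Lemma coord_smooth i p :
  smooth_fun_at (M := vect_structure V) (fun q => coord alpha i q) p.
Proof.
pose e (x : V) : R^o := coord alpha i x.
have e_lin : linear e by move=> a x y; rewrite /e linearP.
pose eM := GRing.isLinear.Build _ _ _ _ e e_lin.
pose eL : {linear V -> R^o} := HB.pack e eM.
rewrite (_ : (fun q => _) = fun q => eL q + 0).
  exact: (affine_smooth eL (0 : R^o)).
by apply/funext => q; rewrite addr0.
Qed.

Lemma coord_act (X : tvect) i :
  tact X (fun q => coord alpha i q) = coord alpha i (tvec X).
Proof.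
rewrite tactE asboolT /dir_derive; last exact: coord_smooth.
pose e (x : 'rV[R]_(\dim {:V})) : R^o := coord alpha i (uncrd x).
have e_lin : linear e by move=> a x y; rewrite /e !linearP.
pose eM := GRing.isLinear.Build _ _ _ _ e e_lin.
pose eL : {linear 'rV[R]_(\dim {:V}) -> R^o} := HB.pack e eM.
by have := lin_derive eL (crd (tbase X)) (crd (tvec X)); rewrite /= /e crdK.
Qed.

Definition psi (X : tvect) : V * 'rV[R]_n :=
  (tbase X, \row_i tact X (fun q => coord alpha i q)).

(* The tangent vector v at p such that v[x_i] = w_i is the velocity of the curve
   t |-> p + t (sum_i w_i alpha_i). *)
Definition psi_inv (z : V * 'rV[R]_n) : tvect :=
  tvmk z.1 (\sum_i z.2 0 i *: alpha`_i).

Definition tbasis : (n + n).-tuple tvect :=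
  cat_tuple [tuple psi_inv (alpha`_i, 0) | i < n]
            [tuple psi_inv (0, delta_mx 0 i) | i < n].

Hypothesis alpha_basis : basis_of {:V} alpha.

Lemma psiK : cancel psi psi_inv.
Proof.
move=> X; apply: tvec_eq; rewrite ?tbase_tvmk ?tvec_tvmk //=.
rewrite [RHS](coord_basis alpha_basis) ?memvf //.
by apply: eq_bigr => i _; rewrite mxE coord_act.
Qed.

Lemma psi_invK : cancel psi_inv psi.
Proof.
move=> [p w]; rewrite /psi tbase_tvmk; congr pair.
apply/rowP => i; rewrite mxE coord_act tvec_tvmk.
by rewrite coord_sum_free // (basis_free alpha_basis).
Qed.

Lemma tbasisP : basis_of {:tvect} tbasis.
Proof.
rewrite basisEdim; apply/andP; split; last first.
  rewrite size_tuple dimvf -[dim tvect]/(\dim {:V} + \dim {:V})%N.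
  by rewrite (size_basis alpha_basis).
apply/subvP => X _.
have tvec0 : tvec 0 = 0 by exact: tvec_tvmk.
have tb0 : tbase (0 : tvect) = 0 :> V by exact: tbase_tvmk.
have tvecD : {morph tvec : X Y / X + Y} by exact: tvec_tadd.
have tbD : {morph (fun X : tvect => tbase X : V) : X Y / X + Y} by [].
have -> : X = \sum_i coord alpha i (tbase X : V) *: psi_inv (alpha`_i, 0) +
              \sum_i coord alpha i (tvec X) *: psi_inv (0, delta_mx 0 i).
  have zE : \sum_(j < n) (0 : 'rV[R]_n) 0 j *: alpha`_j = 0.
    by rewrite big1 // => j _; rewrite mxE scale0r.
  have dE i : \sum_(j < n) (delta_mx 0 i : 'rV[R]_n) 0 j *: alpha`_j = alpha`_i.
    rewrite (bigD1 i) //= mxE !eqxx scale1r big1 ?addr0 // => j ji.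
    by rewrite mxE (negPf ji) andbF scale0r.
  apply: tvec_eq.
    rewrite tbD !(big_morph _ tbD tb0) [in RHS]addrC big1 ?add0r.
      rewrite {1}(coord_basis alpha_basis (memvf (tbase X : V))).
      apply: eq_bigr => i _.
      rewrite -[RHS]/(coord alpha i (tbase X : V) *: (tbase (psi_inv _) : V)).
      by rewrite tbase_tvmk.
    move=> i _.
    rewrite -[LHS]/(coord alpha i (tvec X) *: (tbase (psi_inv _) : V)).
    by rewrite tbase_tvmk scaler0.
  rewrite tvecD !(big_morph _ tvecD tvec0) big1 ?add0r.
    rewrite {1}(coord_basis alpha_basis (memvf (tvec X))).
    by apply: eq_bigr => i _; rewrite tvec_tscale tvec_tvmk dE.
  by move=> i _; rewrite tvec_tscale tvec_tvmk zE ?scaler0.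
apply: rpredD; apply: rpred_sum => i _; apply: rpredZ; apply: memv_span.
  by rewrite /= mem_cat; apply/orP; left; apply/mapP; exists i; rewrite ?mem_enum.
by rewrite /= mem_cat; apply/orP; right; apply/mapP; exists i; rewrite ?mem_enum.
Qed.

End Bases.
End TangentVectorSpace.

Section LieGroups.
Variable R : realType.

Record lie_data := LieData {
  lstruct :> smooth_structure R;
  lmul : lstruct -> lstruct -> lstruct;
  lone : lstruct;
  linv : lstruct -> lstruct }.

Record is_lie_group (G : lie_data) : Prop := IsLieGroup {
  lie_manifold : is_manifold G;
  lmulA : associative (lmul (l := G));
  lmul1 : left_id (lone G) (lmul (l := G));
  lmulV : left_inverse (lone G) (linv (l := G)) (lmul (l := G));
  lmul_smooth : smooth (M := prod_structure G G) (N := G)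
    (fun p => lmul p.1 p.2);
  linv_smooth : smooth (linv (l := G)) }.

Definition is_lie_hom (G H : lie_data) (f : G -> H) : Prop :=
  smooth f /\ forall a b : G, f (lmul a b) = lmul (f a) (f b).

Lemma cst_smooth_curve (M : smooth_structure R) (mM : is_manifold M) (p : M) :
  smooth_curve (fun=> p).
Proof.
have [psi apsi psip] := charts_cover mM p.
exists (Chart setT (@crd R R^o)), psi, setT, (fun=> psi p); split=> //.
- by split=> //; [exact: openT|rewrite /= range_crd].
- by move=> k; exact: Ck_cst.
Qed.

(* TG with the multiplication T(mu), T(G x G) being identified with TG x TG. *)
Definition tangent_lie (G : lie_data) (hG : is_lie_group G) : lie_data :=
  let mG := lie_manifold hG in
  @LieData (tangent_structure G)
    (fun X Y => tmap (prod_manifold mG mG) mG (lmul_smooth hG) (tpair X Y))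
    (curve_tangent (cst_smooth_curve mG (lone G)))
    (tmap mG mG (linv_smooth hG)).

Lemma open_unitmx m n (L : {linear 'rV[R]_m -> 'M[R]_n}) :
  open [set x | L x \in unitmx].
Proof.
have Lc i j : continuous (fun x => L x i j).
  move=> x; apply: (@continuous_comp _ 'M[R]_n _ L (fun M : 'M[R]_n => M i j)).
    exact: (@lin_continuous R m 'M[R]_n L).
  exact: coord_continuous.
have prodc (s : {perm 'I_n}) (r : seq 'I_n) :
    continuous (fun x => \prod_(i <- r) L x i (s i) : R).
  elim: r => [|i r IH] x.
    rewrite [X in continuous_at _ X](_ : _ = fun=> 1); first exact: cst_continuous.
    by apply/funext => y; rewrite big_nil.
  rewrite [X in continuous_at _ X](_ : _ =
    fun y => L y i (s i) * \prod_(i <- r) L y i (s i)).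
    by apply: continuousM; [exact: Lc|exact: IH].
  by apply/funext => y; rewrite big_cons.
have sumc (r : seq {perm 'I_n}) : continuous (fun x => 
    \sum_(s <- r) (-1) ^+ s * \prod_i L x i (s i) : R).
  elim: r => [|s r IH] x.
    rewrite [X in continuous_at _ X](_ : _ = fun=> 0); first exact: cst_continuous.
    by apply/funext => y; rewrite big_nil.
  rewrite [X in continuous_at _ X](_ : _ = fun y =>
    (-1) ^+ s * \prod_i L y i (s i) + \sum_(s <- r) (-1) ^+ s * \prod_i L y i (s i)).
    apply: (@continuousD R R^o _ (fun y => (-1) ^+ s * \prod_i L y i (s i)) _ x _ (IH x)).
    by apply: continuousM; [exact: cst_continuous|exact: prodc].
  by apply/funext => y; rewrite big_cons.
rewrite (_ : [set x | _] = (fun x => \det (L x)) @^-1` [set y | y != 0]).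
  by apply: open_comp; [move=> x _; exact: sumc|exact: open_neq].
by apply/seteqP; split=> x /=; rewrite unitmxE unitfE.
Qed.

Definition gl_structure (n : nat) : smooth_structure R :=
  open_structure (fun a : 'M[R]_n => a \in unitmx).

Lemma gl_open n : open [set x | @uncrd R 'M[R]_n x \in unitmx].
Proof.
pose L : {linear 'rV[R]_(\dim {:'M[R]_n}) -> 'M[R]_n} := @uncrd R 'M[R]_n.
exact: (@open_unitmx _ _ L).
Qed.

Lemma gl_manifold n : is_manifold (gl_structure n).
Proof. exact: (@open_manifold _ _ _ (@gl_open n)). Qed.

Definition gl_mul n (a b : gl_structure n) : gl_structure n :=
  exist _ (val a *m val b) (etrans (unitmx_mul _ _) (andb_true_intro (conj (valP a) (valP b)))).

Definition gl_inv n (a : gl_structure n) : gl_structure n :=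
  exist _ (invmx (val a)) (etrans (unitmx_inv _) (valP a)).

Definition gl_right n (a : gl_structure n) : gl_structure n -> gl_structure n :=
  fun y => gl_mul y a.

Lemma gl_right_smooth n (a : gl_structure n) : smooth (gl_right a).
Proof.
exact: (@open_linear_smooth R _ _ _ _ (gl_right a)
  (mulmxr (val a) : {linear 'M[R]_n -> 'M[R]_n}) (@gl_open n)).
Qed.

(* The matrix B, viewed as an element of T_e GL(n), such that X = TR_a(B), where
   a is the base point of X. *)
Definition right_trivialization n (X : tangent (gl_structure n)) : 'M[R]_n :=
  \matrix_(i, j)
    tact (tmap (gl_manifold n) (gl_manifold n)
               (gl_right_smooth (gl_inv (tbase X))) X)
         (fun y => val y i j).

Fact Jn_subproof n (a B : 'M[R]_n) :
  a \in unitmx -> block_mx a 0 (B *m a) a \in unitmx.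
Proof. by rewrite !unitmxE det_lblock unitrM => ->. Qed.

Definition Jn n (X : tangent (gl_structure n)) : gl_structure (n + n) :=
  let a : 'M[R]_n := val (tbase X) in
  let B := right_trivialization X in
  exist _ (block_mx a 0 (B *m a) a) (Jn_subproof B (valP (tbase X))).

End LieGroups.

Section Automorphisms.
Variables (R : realType) (V : vectType R).

Definition aut_structure : smooth_structure R :=
  open_structure (fun f : 'End(V) => lker f == 0%VS).

Fact aut_mul_subproof (f g : aut_structure) :
  lker (val f \o val g)%VF == 0%VS.
Proof.
have /lker0P finj := valP f; have /lker0P ginj := valP g.
by apply/lker0P => x y; rewrite !comp_lfunE => /finj /ginj.
Qed.

Fact aut_one_subproof : lker (\1%VF : 'End(V)) == 0%VS.
Proof. by apply/lker0P => x y; rewrite !id_lfunE. Qed.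

Fact aut_inv_subproof (f : aut_structure) : lker (val f)^-1%VF == 0%VS.
Proof. by apply/lker0P; exact: can_inj (lker0_lfunVK (valP f)). Qed.

Definition aut_mul (f g : aut_structure) : aut_structure :=
  exist _ (val f \o val g)%VF (aut_mul_subproof f g).

Definition aut_one : aut_structure := exist _ \1%VF aut_one_subproof.

Definition aut_inv (f : aut_structure) : aut_structure :=
  exist _ (val f)^-1%VF (aut_inv_subproof f).

Definition aut_lie : lie_data R := LieData aut_mul aut_one aut_inv.

Section Matrix.
Variables (n : nat) (e : n.-tuple V).

(* The j-th column contains the coordinates of f(e_j). *)
Definition end_mx (f : 'End(V)) : 'M[R]_n :=
  \matrix_(i, j) coord e i (f e`_j).

Definition mx_end (a : 'M[R]_n) : 'End(V) :=
  linfun (fun v => \sum_i (\sum_j a i j * coord e j v) *: e`_i).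

Lemma end_mx_linear : linear end_mx.
Proof. by move=> k f g; apply/matrixP => i j; rewrite !mxE add_lfunE scale_lfunE linearP. Qed.

HB.instance Definition _ :=
  GRing.isLinear.Build R 'End(V) 'M[R]_n _ end_mx end_mx_linear.

Lemma mx_endE a v : mx_end a v = \sum_i (\sum_j a i j * coord e j v) *: e`_i.
Proof.
pose h v := \sum_i (\sum_j a i j * coord e j v) *: e`_i.
have h_lin : linear h.
  move=> k x y; rewrite /h scaler_sumr -big_split; apply: eq_bigr => i _ /=.
  rewrite scalerA -scalerDl mulr_sumr -big_split; congr (_ *: _).
  by apply: eq_bigr => j _ /=; rewrite linearP mulrDr mulrCA.
pose hM := GRing.isLinear.Build _ _ _ _ h h_lin.
pose hL : {linear V -> V} := HB.pack h hM.
exact: (lfunE hL).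
Qed.

Hypothesis e_basis : basis_of {:V} e.

Let eE v : v = \sum_i coord e i v *: e`_i.
Proof. by rewrite -(coord_basis e_basis) ?memvf. Qed.

Let coord_e (c : 'I_n -> R) i : coord e i (\sum_j c j *: e`_j) = c i.
Proof. exact: coord_sum_free (basis_free e_basis). Qed.

Lemma end_mxK : cancel end_mx mx_end.
Proof.
move=> f; apply/lfunP => v; rewrite mx_endE [in RHS](eE v) linear_sum.
rewrite [RHS]eE; apply: eq_bigr => i _; congr (_ *: _).
by rewrite linear_sum; apply: eq_bigr => j _; rewrite !mxE !linearZ mulrC.
Qed.

Lemma mx_endK : cancel mx_end end_mx.
Proof.
move=> a; apply/matrixP => i j; rewrite mxE mx_endE coord_e (bigD1 j) //=.
rewrite coord_free ?(basis_free e_basis) // eqxx mulr1 big1 ?addr0 // => k kj.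
by rewrite coord_free ?(basis_free e_basis) // eq_sym (negPf kj) mulr0.
Qed.

Lemma mx_end_mul a b : mx_end (a *m b) = (mx_end a \o mx_end b)%VF.
Proof.
apply/lfunP => v; rewrite comp_lfunE !mx_endE; apply: eq_bigr => i _.
congr (_ *: _); under [RHS]eq_bigr do rewrite coord_e mulr_sumr.
rewrite exchange_big; apply: eq_bigr => j _ /=.
by rewrite mxE mulr_suml; apply: eq_bigr => k _; rewrite mulrA.
Qed.

Lemma mx_end1 : mx_end 1%:M = \1%VF.
Proof.
apply/lfunP => v; rewrite mx_endE id_lfunE [RHS]eE; apply: eq_bigr => i _.
congr (_ *: _); rewrite (bigD1 i) //= mxE eqxx mul1r big1 ?addr0 // => j ji.
by rewrite mxE eq_sym (negPf ji) mul0r.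
Qed.

Lemma end_mx_unit f : (end_mx f \in unitmx) = (lker f == 0%VS).
Proof.
apply/idP/idP => [uf|f0].
  apply/lker0P/(can_inj (g := mx_end (invmx (end_mx f)))) => v.
  by rewrite -{2}[f]end_mxK -comp_lfunE -mx_end_mul mulVmx // mx_end1 id_lfunE.
suff h : end_mx f *m end_mx f^-1%VF = 1%:M by case: (mulmx1_unit h).
apply: (can_inj mx_endK); rewrite mx_end_mul !end_mxK mx_end1.
exact: lker0_compfV.
Qed.

Definition aut_mx (f : aut_structure) : gl_structure R n :=
  exist _ (end_mx (val f)) (etrans (end_mx_unit _) (valP f)).

Fact mx_aut_subproof (a : gl_structure R n) : lker (mx_end (val a)) == 0%VS.
Proof. by rewrite -end_mx_unit mx_endK; exact: valP. Qed.

Definition mx_aut (a : gl_structure R n) : aut_structure :=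
  exist _ (mx_end (val a)) (mx_aut_subproof a).

Lemma aut_mxK : cancel aut_mx mx_aut.
Proof. by move=> f; apply: val_inj; rewrite /= end_mxK. Qed.

Lemma mx_autK : cancel mx_aut aut_mx.
Proof. by move=> a; apply: val_inj; rewrite /= mx_endK. Qed.

End Matrix.

Lemma aut_open : open [set x | lker (@uncrd R 'End(V) x) == 0%VS].
Proof.
rewrite (_ : [set x | _] =
  [set x | (end_mx (vbasis {:V}) \o @uncrd R 'End(V)) x \in unitmx]).
  pose L : {linear 'rV[R]_(\dim {:'End(V)}) -> 'M[R]_(\dim {:V})} :=
    end_mx (vbasis {:V}) \o @uncrd R 'End(V).
  exact: (@open_unitmx _ _ _ L).
by apply/seteqP; split=> x /=; rewrite end_mx_unit ?vbasisP.
Qed.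

Lemma aut_manifold : is_manifold aut_structure.
Proof. exact: (@open_manifold _ _ _ (@aut_open)). Qed.

Lemma aut_mx_smooth n (e : n.-tuple V) (e_basis : basis_of {:V} e) :
  smooth (aut_mx e_basis).
Proof.
exact: (@open_linear_smooth R _ _ _ _ (aut_mx e_basis)
  (end_mx e : {linear 'End(V) -> 'M[R]_n}) (@aut_open)).
Qed.

End Automorphisms.

Section Representations.
Variable R : realType.

Definition is_representation (G : lie_data R) (V : vectType R)
    (Phi : G -> aut_lie V) : Prop :=
  is_lie_hom Phi.

Definition equivalent_representations (G : lie_data R) (V V' : vectType R)
    (Phi : G -> aut_lie V) (Phi' : G -> aut_lie V') : Prop :=
  exists A : 'Hom(V, V'), [/\ lker A = 0%VS, limg A = fullv &
    forall a p, A (val (Phi a) p) = val (Phi' a) (A p)].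

(* Zbreve^-1 o J_n o TZ o TPhi *)
Definition prolongation (G : lie_data R) (hG : is_lie_group G) (V : vectType R)
    (n : nat) (alpha : n.-tuple V) (alphaP : basis_of {:V} alpha)
    (Phi : G -> aut_lie V) (hPhi : is_representation Phi) :
    tangent_lie hG -> aut_lie (tvect V) :=
  let TPhi := tmap (lie_manifold hG) (aut_manifold V) (proj1 hPhi) in
  let TZ := tmap (aut_manifold V) (gl_manifold R n) (aut_mx_smooth alphaP) in
  let Zbreve_inv := mx_aut (tbasisP alphaP) in
  fun X => Zbreve_inv (Jn (TZ (TPhi X))).

End Representations.

Arguments prolongation {R G} hG {V n alpha} alphaP {Phi} hPhi _.

(* Main.v *)
(* For a smooth map f from a manifold into a vector space W, write f_X in W for
   the derivative of f along a tangent vector X. With f = Phi, regarded as a map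
   into End(V), the matrix of the prolongation at X in T_xG is
   [[Phi(x), 0], [Phi_X, Phi(x)]], that is, it sends (p, v) in V x V = TV to
   (Phi(x) p, Phi_X p + Phi(x) v). Smoothness follows because, in a chart, the
   coordinates of f_X are sums of products of the coordinates of X with partial
   derivatives of f; multiplicativity is the product rule
   Phi_(XY) = Phi_X Phi(y) + Phi(x) Phi_Y. Differentiating A Phi = Phi' A gives
   A Phi_X = Phi'_X A, so TA = A x A intertwines the two prolongations. *)
Require Import Defs.
From HB Require Import structures.
From mathcomp Require Import all_boot all_order fingroup perm all_algebra.
From mathcomp Require Import all_classical all_reals all_analysis.
Set Implicit Arguments.
Unset Strict Implicit.
Unset Printing Implicit Defensive.
Import Order.TTheory GRing.Theory Num.Theory numFieldNormedType.Exports.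
Local Open Scope classical_set_scope.
Local Open Scope ring_scope.

(** * Derivatives of vector-valued maps along tangent vectors *)

Section VectorValuedDerivative.
Context {R : realType}.
Implicit Types (M : smooth_structure R) (W U : vectType R).

Lemma linear_smooth_at W U (L : {linear W -> U}) p :
  smooth_at (M := vect_structure W) (N := vect_structure U) L p.
Proof.
rewrite (_ : (L : W -> U) = fun q => L q + 0); first exact: affine_smooth.
by apply/funext => q; rewrite addr0.
Qed.

Lemma val_smooth_at W (P : pred W) (p : {v : W | P v}) :
  open [set x | P (@uncrd R W x)] ->
  smooth_at (M := open_structure P) (N := vect_structure W)
    (fun q : {v : W | P v} => val q) p.
Proof.
rewrite -range_open => oP.
apply: (@global_smooth_at _ _ _ _ _ _ _ _ id) => // k.
exact: (Ck_lin k _ (idfun : {linear _ -> _})).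
Qed.

Lemma smooth_fun_at_linear M W (f : M -> vect_structure W) p
    (l : W -> R^o) : linear l ->
  smooth_at f p -> smooth_fun_at (fun q => l (f q)) p.
Proof.
move=> l_lin sf.
pose lM := GRing.isLinear.Build _ _ _ _ l l_lin.
pose lL : {linear W -> R^o} := HB.pack l lM.
exact: (smooth_at_comp (vect_manifold W) sf (linear_smooth_at lL _)).
Qed.

Lemma smooth_curve_differentiable M (mM : is_manifold M) W
    (f : M -> vect_structure W) (c : R -> M) :
  smooth_curve c -> smooth_at f (c 0) ->
  differentiable (fun t => crd (f (c t) : W)) 0.
Proof.
move=> sc sf; apply: vect_smooth_curveP.
exact: (smooth_at_comp mM sc sf).
Qed.

(** The vector f_X, assembled from its coordinates. It has this meaning when [f] is smooth at the
    base point; otherwise [tact] can return its default value 0. *)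
Definition tderiv M W (f : M -> W) (X : tangent M) : W :=
  uncrd (\row_i tact X (fun q => crd (f q) 0 i)).

Lemma crd_coord_linear W i : linear (fun x : W => crd x 0 i : R^o).
Proof. by move=> a x y; rewrite linearP !mxE. Qed.

Lemma tderiv_curve M (mM : is_manifold M) W (f : M -> W) (X : tangent M)
    (c : R -> M) :
  smooth_at (N := vect_structure W) f (tbase X) ->
  smooth_curve c -> c 0 = tbase X -> tact X = velocity c ->
  tderiv f X = uncrd ('D_1 (fun t => crd (f (c t))) 0).
Proof.
move=> sf sc c0 cE; congr uncrd; apply/rowP => i.
rewrite -c0 in sf.
rewrite mxE cE /velocity asboolT; last first.
  exact: (@smooth_fun_at_linear M W f _ (fun x => crd x 0 i)
            (@crd_coord_linear W i) sf).
rewrite derive1E (@derive_coord R R^o 1 _ (fun t => crd (f (c t)))) //.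
exact: (smooth_curve_differentiable mM).
Qed.

(** A linear functional commutes with differentiation along a curve representing [X]. This reduces
    identities between derivatives f_X to scalar ones. *)
Lemma tact_linear M (mM : is_manifold M) W (f : M -> W) (X : tangent M)
    (l : W -> R^o) : linear l ->
  smooth_at (N := vect_structure W) f (tbase X) ->
  tact X (fun q => l (f q)) = l (tderiv f X).
Proof.
move=> l_lin sf; have [c [sc c0 cE]] := tangentP X.
rewrite (tderiv_curve mM sf sc c0 cE) cE /velocity asboolT; last first.
  rewrite c0; exact: (@smooth_fun_at_linear M W f _ l l_lin sf).
pose lM := GRing.isLinear.Build _ _ _ _ l l_lin.
pose lL : {linear W -> R^o} := HB.pack l lM.
rewrite -c0 in sf.
have dc := smooth_curve_differentiable mM sc sf.
rewrite derive1E (_ : (fun t => _) =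
    (lL \o @uncrd R W) \o (fun t => crd (f (c t)))).
  by rewrite derive_lin_comp.
by apply/funext => t /=; rewrite crdK.
Qed.

(** Read in the chart itself, the local expression is the linear map [crd] on row vectors. *)
Lemma chart_smooth_at M (mM : is_manifold M) (phi : chart R M (sdim M)) p :
  atlas phi -> cdom phi p ->
  smooth_at (N := vect_structure 'rV[R]_(sdim M)) phi p.
Proof.
move=> aphi pphi.
exists phi, (Chart setT (@crd R _)), (phi @` cdom phi), (@crd R _); split=> //.
  by split=> //; exact: chart_open.
by move=> k; exact: Ck_lin.
Qed.

(** Smoothness gives a continuous local expression of [c] in some chart [psi] only. Compatibility
    makes the overlap of [psi] and [phi] open in the coordinates of [psi], so [c] stays in the
    overlap for small times. *)
Lemma smooth_curve_in_chart M (mM : is_manifold M) (phi : chart R M (sdim M))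
    (c : R -> M) :
  smooth_curve c -> atlas phi -> cdom phi (c 0) ->
  \forall t \near (0 : R), cdom phi (c t).
Proof.
move=> [chi [psi [W [F [[achi _ apsi psic] [oW W0 WU] cF FE]]]]] aphi phic.
move: achi; rewrite /= => ?; subst chi.
have [oO _] := charts_compatible mM apsi aphi.
set O := psi @` _ in oO.
have cR : {for (0 : R), continuous (@crd R R^o : R -> _)}.
  rewrite (_ : (@crd R R^o : R -> _) = fun t => t *: @crd R R^o 1).
    apply: differentiable_continuous; exact: differentiableZl.
  apply/funext => t; rewrite -linearZ; congr crd; exact: (esym (mulr1 _)).
have oF : open (W `&` F @^-1` O).
  by apply: (open_preimage_in oW oO) => x Wx; exact: (cF 0%N _ Wx).
have [_ F0] := FE 0 I W0.
have : \forall t \near (0 : R), (W `&` F @^-1` O) (@crd R R^o t).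
  apply: cR; apply: open_nbhs_nbhs; split => //; split => //=.
  by rewrite -F0; exists (c 0).
apply: filterS => t [Wt [q [psiq phiq] qE]].
have [psict Fct] := FE t I Wt.
(* The point [q] of the overlap has the same [psi]-coordinates as [c t], so injectivity of [psi]
   identifies the two. *)
rewrite (_ : c t = q) //; apply: (chart_inj mM apsi); rewrite ?inE //.
by rewrite qE.
Qed.

(** Chain rule along a curve [c] representing [X]: near time 0, f o c is F o phi o c in coordinates,
    and phi o c has velocity X[x_i]. *)
Lemma tderiv_chart M (mM : is_manifold M) (phi : chart R M (sdim M)) W
    (f : M -> W) (X : tangent M) (O : set 'rV[R]_(sdim M)) F :
  smooth_at (N := vect_structure W) f (tbase X) ->
  atlas phi -> cdom phi (tbase X) -> open O -> O (phi (tbase X)) ->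
  differentiable F (phi (tbase X)) ->
  (forall q, cdom phi q -> O (phi q) -> crd (f q) = F (phi q)) ->
  crd (tderiv f X) =
    'D_(\row_i tact X (fun q => phi q 0 i)) F (phi (tbase X)).
Proof.
move=> sf aphi phiX oO OX dF FE; have [c [sc c0 cE]] := tangentP X.
have sphi := chart_smooth_at mM aphi phiX.
have dphi : differentiable (fun t => phi (c t)) 0.
  have := sphi; rewrite -c0 => /(smooth_curve_differentiable mM sc) d.
  pose L : {linear 'rV[R]_(\dim {:'rV[R]_(sdim M)}) -> 'rV[R]_(sdim M)} :=
    @uncrd R 'rV[R]_(sdim M).
  have := differentiable_comp d (lin_differentiable L _).
  rewrite (_ : _ \o _ = fun t => phi (c t)) //.
  by apply/funext => t /=; rewrite crdK.
have -> : \row_i tact X (fun q => phi q 0 i) = 'D_1 (fun t => phi (c t)) 0.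
  apply/rowP => i; rewrite mxE -(derive_coord _ 0 i dphi) cE /velocity.
  rewrite derive1E asboolT // c0.
  apply: (@smooth_fun_at_linear M 'rV[R]_(sdim M) phi _ (fun x => x 0 i)) => //.
  by move=> a x y; rewrite !mxE.
rewrite (tderiv_curve mM sf sc c0 cE) uncrdK.
have nO : \forall t \near (0 : R), O (phi (c t)).
  apply: (differentiable_continuous dphi).
  by apply: open_nbhs_nbhs; split=> //; rewrite c0.
have nphi : \forall t \near (0 : R), cdom phi (c t).
  by apply: smooth_curve_in_chart; rewrite ?c0.
rewrite (@near_eq_derive _ _ _ _ (F \o (fun t => phi (c t)))); last first.
  near=> t; rewrite /= FE //; by near: t.
rewrite -c0 in dF *.
rewrite deriveE; last exact: differentiable_comp.
by rewrite diff_comp // [in RHS](deriveE _ dF) [in RHS](deriveE _ dphi).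
Unshelve. all: by end_near. Qed.

End VectorValuedDerivative.

(** * Smooth maps out of the tangent bundle *)

Section TangentBundle.
Context {R : realType}.
Implicit Types (M : smooth_structure R) (W U : vectType R).

(** Lift to [M] the line through [lsubmx z] with direction [rsubmx z] and take its velocity.
    Surjectivity is needed because [smooth_at] asks the domain of a local expression to lie in the
    image of the chart. *)
Lemma tangent_chart_surj M (mM : is_manifold M) (phi : chart R M (sdim M))
    (z : 'rV[R]_(sdim M + sdim M)) :
  atlas phi -> (phi @` cdom phi) (lsubmx z) ->
  exists2 X : tangent M, cdom (tangent_chart phi) X & tangent_chart phi X = z.
Proof.
move=> aphi [p phip pz].
pose e (t : R^o) := t *: rsubmx z.
have e_lin : linear e by move=> a x y; rewrite /e scalerDl scalerA.
pose eM := GRing.isLinear.Build _ _ _ _ e e_lin.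
pose eL : {linear R^o -> 'rV[R]_(sdim M)} := HB.pack e eM.
pose L : {linear 'rV[R]_(\dim {:R^o}) -> 'rV[R]_(sdim M)} := eL \o @uncrd R R^o.
(* c t = phi^-1 (e t + lsubmx z) while this point is in the image of the chart *)
have /choice [c cP] (t : R) : exists q, (phi @` cdom phi) (e t + lsubmx z) ->
    cdom phi q /\ phi q = e t + lsubmx z.
  have [[q phiq qE]|nz] := pselect ((phi @` cdom phi) (e t + lsubmx z)).
    by exists q.
  by exists p => /nz.
have e0 : e 0 = 0 by rewrite /e scale0r.
have [phic0 c0] : cdom phi (c 0) /\ phi (c 0) = e 0 + lsubmx z.
  by apply: cP; rewrite e0 add0r; exists p.
have cp : c 0 = p.
  by apply: (chart_inj mM aphi); rewrite ?inE // c0 e0 add0r.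
pose W := (fun x => L x + lsubmx z) @^-1` (phi @` cdom phi).
have oW : open W.
  apply: open_comp; last exact: chart_open.
  by move=> x _; apply: continuousD; [exact: lin_continuous|exact: cst_continuous].
have LE t : L (@crd R R^o t) = e t by rewrite /L /= crdK.
have sc : smooth_curve c.
  exists (Chart setT (@crd R R^o)), phi, W, (fun x => L x + lsubmx z); split=> //.
  - split=> //; first by rewrite /W /= crdK -c0; exists (c 0).
    by rewrite range_crd.
  - exact: Cinf_affine.
  - by move=> t _; rewrite /W /= crdK => /cP.
exists (curve_tangent sc) => //.
rewrite /= c0 e0 add0r -[RHS]hsubmxK; congr row_mx; apply/rowP => i.
rewrite mxE /velocity asboolT; last first.
  apply: (@smooth_fun_at_linear R M 'rV[R]_(sdim M) phi _ (fun x => x 0 i)) => //.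
    by move=> a x y; rewrite !mxE.
  exact: chart_smooth_at.
(* The lift follows the line only inside the open chart image, which contains the line for small
   times; that suffices for the derivative at 0. *)
have nW : \forall t \near (0 : R), (phi @` cdom phi) (e t + lsubmx z).
  have ce : {for 0, continuous (fun t : R => e t + lsubmx z)}.
    apply: continuousD; last exact: cst_continuous.
    exact: (@scalel_continuous R 'rV[R]_(sdim M) (rsubmx z) 0).
  apply: ce; apply: open_nbhs_nbhs; split; first exact: chart_open.
  by rewrite -c0; exists (c 0).
rewrite derive1E.
rewrite (@near_eq_derive _ _ _ _ (fun t : R => lsubmx z 0 i + t * rsubmx z 0 i)).
- rewrite deriveD // derive_cst add0r -derive1E derive1Mr // derive1_id.
  by rewrite mul1r.
- by apply: filterS nW => t /cP [_ ->]; rewrite addrC !mxE.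
Qed.

Lemma Cinf_derive m n (O : set 'rV[R]_m) (F : 'rV[R]_m -> 'rV[R]_n) v :
  Cinf O F -> Cinf O (fun x => 'D_v F x).
Proof. by move=> cF k; have [_] := cF k.+1; exact. Qed.

(** Isolating the entries of the direction as factors makes joint smoothness in point and direction
    visible. *)
Lemma derive_row_sum m n (F : 'rV[R]_m -> 'rV[R]_n) x (v : 'rV[R]_m) :
  differentiable F x -> 'D_v F x = \sum_i v 0 i *: 'D_(delta_mx 0 i) F x.
Proof.
move=> dF; rewrite deriveE // {1}(row_sum_delta v) linear_sum.
by apply: eq_bigr => i _; rewrite linearZ [in RHS]deriveE.
Qed.

(** The shape of [val (h X)] fits the block matrix of a prolongation: [L1] supplies the diagonal
    blocks and [L2] the lower-left one. *)
Lemma smooth_tderiv_linear M (mM : is_manifold M) W U (Q : pred U)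
    (f : M -> W) (h : tangent M -> {u : U | Q u}) (L1 L2 : {linear W -> U}) :
  smooth (N := vect_structure W) f ->
  (forall X, val (h X) = L1 (f (tbase X)) + L2 (tderiv f X)) ->
  smooth (M := tangent_structure M) (N := open_structure Q) h.
Proof.
move=> sf hE X; have := sf (tbase X).
move=> [phi [psi [A [F [[aphi phip apsi psifp] [oA Ap AU] cF FE]]]]].
move: apsi; rewrite /= => ?; subst psi.
pose n := sdim M.
pose lS : {linear 'rV[R]_(n + n) -> 'rV[R]_n} := @lsubmx R 1 n n.
pose rS : {linear 'rV[R]_(n + n) -> 'rV[R]_n} := @rsubmx R 1 n n.
pose K1 : {linear 'rV[R]_(\dim {:W}) -> 'rV[R]_(\dim {:U})} :=
  @crd R U \o L1 \o @uncrd R W.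
pose K2 : {linear 'rV[R]_(\dim {:W}) -> 'rV[R]_(\dim {:U})} :=
  @crd R U \o L2 \o @uncrd R W.
pose A' := lS @^-1` A.
have oA' : open A' by apply: open_comp => // x _; exact: lin_continuous.
pose D i x := 'D_(delta_mx 0 i) F x.
(* The local expression at z = (x, v): [K1] and [K2] are [L1] and [L2] in coordinates, and the sum
   is the derivative of [F] at x in direction v. *)
pose G z := K1 (F (lS z)) + K2 (\sum_(i < n) (rS z) 0 i *: D i (lS z)).
exists (tangent_chart phi), (Chart setT (fun x : {u : U | Q u} => crd (val x))), A', G.
have comp_lin k p (H : 'rV[R]_n -> 'rV[R]_p) : Ck k A H -> Ck k A' (H \o lS).
  by move=> cH; apply: (Ck_comp oA' _ (Ck_lin k _ lS) cH).
have lin_comp k p q (K : {linear 'rV[R]_p -> 'rV[R]_q})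
    (H : 'rV[R]_(n + n) -> 'rV[R]_p) : Ck k A' H -> Ck k A' (K \o H).
  by move=> cH; apply: (@Ck_comp _ _ _ _ _ _ setT) => //; exact: Ck_lin.
split.
- by split=> //; exists phi.
- split=> //; first by rewrite /A' /= row_mxKl.
  move=> z Az; have [Y phiY Yz] := tangent_chart_surj mM aphi (AU _ Az).
  by exists Y.
- move=> k; apply: Ck_add => //.
    exact: (lin_comp _ _ _ K1 (F \o lS) (comp_lin _ _ _ (cF k))).
  apply: (lin_comp _ _ _ K2 (fun z => _)).
  apply: Ck_sum => // i.
  apply: (@Ck_scal _ _ _ _ _ _ rS (D i \o lS)) => //; first exact: Ck_lin.
  exact: (comp_lin _ _ _ (Cinf_derive (delta_mx 0 i) cF k)).
- move=> Y /= phiY; rewrite /A' /= row_mxKl => AY; split=> //.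
  have dF : differentiable F (phi (tbase Y)) by case: (cF 1%N) => + _; exact.
  have [_ /= fY] := FE _ phiY AY.
  rewrite hE linearD /G /= !row_mxKl row_mxKr -fY crdK; congr (_ + crd (L2 _)).
  rewrite -derive_row_sum // -(tderiv_chart mM (sf _) aphi phiY oA AY dF).
    by rewrite crdK.
  by move=> q phiq Aq; have [_] := FE _ phiq Aq.
Qed.

End TangentBundle.

(** * The product rule on the tangent group *)

Section ProductRule.
Context {R : realType}.
Implicit Types (M N : smooth_structure R) (W : vectType R).

Lemma is_derive_tderiv M (mM : is_manifold M) W (f : M -> W) (X : tangent M)
    (c : R -> M) (l : W -> R^o) : linear l ->
  smooth_at (N := vect_structure W) f (tbase X) ->
  smooth_curve c -> c 0 = tbase X -> tact X = velocity c ->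
  is_derive (0 : R) (1 : R) (fun t => l (f (c t)) : R) (l (tderiv f X)).
Proof.
move=> l_lin sf sc c0 cE; rewrite -(tact_linear mM l_lin sf) cE /velocity.
have sl : smooth_fun_at (fun q => l (f q)) (c 0).
  rewrite c0; exact: (@smooth_fun_at_linear R M W f _ l l_lin sf).
rewrite asboolT // derive1E; apply: DeriveDef => //; apply/derivable1_diffP.
have d := smooth_curve_differentiable mM (W := R^o) sc sl.
have := differentiable_comp d (lin_differentiable (@uncrd R R^o : {linear _ -> R^o}) _).
rewrite (_ : _ \o _ = fun t => l (f (c t))) //.
by apply/funext => t /=; rewrite crdK.
Qed.

(** If [g] is smooth at the image point, so is g o f at [c 0]; hence the smoothness tests on the two
    sides agree. *)
Lemma tact_tmap_curve M N (mM : is_manifold M) (mN : is_manifold N)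
    (f : M -> N) (sf : smooth f) (c : R -> M) (sc : smooth_curve c) :
  tact (tmap mM mN sf (curve_tangent sc)) = velocity (fun t => f (c t)).
Proof.
apply/funext => g; rewrite /= /tmap_act [in RHS]/velocity /=.
case: asboolP => // sg; rewrite /velocity asboolT //.
exact: (smooth_at_comp mN (sf _) sg).
Qed.

Lemma tbase_lmul (G : lie_data R) (hG : is_lie_group G) (X Y : tangent_lie hG) :
  tbase (lmul X Y) = lmul (tbase X : G) (tbase Y).
Proof. by rewrite /=; case: (tcurveP X) => _ -> _; case: (tcurveP Y) => _ -> _. Qed.

Lemma coord_apply_linear W n (e : n.-tuple W) i w :
  linear (fun h : 'End(W) => coord e i (h w) : R^o).
Proof. by move=> a h k; rewrite add_lfunE scale_lfunE linearP. Qed.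

Lemma end_mx_comp W n (e : n.-tuple W) (h k : 'End(W)) : basis_of {:W} e ->
  end_mx e (h \o k)%VF = end_mx e h *m end_mx e k.
Proof.
by move=> eP; apply: (can_inj (mx_endK eP)); rewrite mx_end_mul // !end_mxK.
Qed.

(** In a basis, each matrix entry of [f] along the product curve is a finite sum of products of
    scalar functions, to which the scalar Leibniz rule applies. *)
Lemma tderiv_lmul (G : lie_data R) (hG : is_lie_group G) W (f : G -> 'End(W))
    (X Y : tangent_lie hG) :
  smooth (N := vect_structure 'End(W)) f ->
  (forall a b, f (lmul a b) = (f a \o f b)%VF) ->
  tderiv f (lmul X Y) =
    (tderiv f X \o f (tbase Y))%VF + (f (tbase X) \o tderiv f Y)%VF.
Proof.
move=> sf fM; have mG := lie_manifold hG.
have [sc c0 cE] := tcurveP X; have [sd d0 dE] := tcurveP Y.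
set c := tcurve X in sc c0 cE; set d := tcurve Y in sd d0 dE.
pose e := vbasis {:W}; have eP : basis_of {:W} e := vbasisP _.
apply: (can_inj (end_mxK eP)); rewrite [RHS]linearD [RHS]/= !end_mx_comp //.
apply/matrixP => i j; rewrite [LHS]mxE.
have spair : smooth_curve (M := prod_structure G G) (fun t => (c t, d t)).
  exact: smooth_at_pair.
have scd : smooth_curve (fun t => lmul (c t) (d t)).
  exact: (smooth_at_comp (prod_manifold mG mG) spair (lmul_smooth hG _)).
(* By definition [lmul X Y] is the tangent map of the multiplication applied to the velocity of (c,
   d), so the product curve represents it. *)
have h1 := is_derive_tderiv mG (coord_apply_linear e i e`_j) (sf _) scd
  (erefl : _ = tbase (lmul X Y)) (tact_tmap_curve _ _ _ _).
pose a k t : R := coord e i (f (c t) e`_k).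
pose b k t : R := coord e k (f (d t) e`_j).
have dX (k : 'I_(\dim {:W})) :
    is_derive (0 : R) (1 : R) (a k) (coord e i (tderiv f X e`_k)).
  exact: (is_derive_tderiv mG (coord_apply_linear e i e`_k) (sf _) sc c0 cE).
have dY (k : 'I_(\dim {:W})) :
    is_derive (0 : R) (1 : R) (b k) (coord e k (tderiv f Y e`_j)).
  exact: (is_derive_tderiv mG (coord_apply_linear e k e`_j) (sf _) sd d0 dE).
have h2 := is_derive_sum (fun k => is_deriveM (dX k) (dY k)).
have E : (fun t => coord e i (f (lmul (c t) (d t)) e`_j)) =
    \sum_(k < \dim {:W}) (a k * b k).
  apply/funext => t; rewrite fct_sumE fM comp_lfunE.
  rewrite {1}(coord_basis eP (memvf (f (d t) e`_j))) !linear_sum.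
  by apply: eq_bigr => k _; rewrite !linearZ mulrC.
(* [h1] and [h2] give the derivative of the same function, so their values agree. *)
rewrite E in h1; case: h1 => _ <-; case: h2 => _ ->.
rewrite !mxE -big_split; apply: eq_bigr => k _ /=.
by rewrite !mxE /a /b c0 d0 addrC; congr (_ + _); rewrite mulrC.
Qed.

End ProductRule.

(** * Derivatives under linear maps, tangent maps and intertwiners *)

Section TangentMap.
Context {R : realType}.
Implicit Types (M N : smooth_structure R) (W U : vectType R).

Lemma tderiv_linear M (mM : is_manifold M) W U (f : M -> W) (X : tangent M)
    (L : {linear W -> U}) : smooth_at (N := vect_structure W) f (tbase X) ->
  tderiv (fun q => L (f q)) X = L (tderiv f X).
Proof.
move=> sf; apply: (can_inj (@crdK R U)); rewrite uncrdK.
apply/rowP => i; rewrite mxE.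
apply: (tact_linear (l := fun x => crd (L x) 0 i) mM) => //.
by move=> a x y; rewrite !linearP !mxE.
Qed.

(** This is (Th)(X)[g] = X[g o h] for the coordinates of [f], whose smoothness discharges the test
    in [tmap_act]. *)
Lemma tderiv_tmap M N (mM : is_manifold M) (mN : is_manifold N) (h : M -> N)
    (sh : smooth h) W (f : N -> W) (X : tangent M) :
  smooth_at (N := vect_structure W) f (h (tbase X)) ->
  tderiv f (tmap mM mN sh X) = tderiv (fun q => f (h q)) X.
Proof.
move=> sf; congr uncrd; apply/rowP => i; rewrite !mxE /= /tmap_act asboolT //.
exact: (@smooth_fun_at_linear R N W f _ (fun x => crd x 0 i)
          (@crd_coord_linear R W i) sf).
Qed.

(** By [tact_linear], each coordinate of either side is [X] applied to a scalar function, and the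
    hypothesis makes these two functions equal. *)
Lemma tderiv_intertwine M (mM : is_manifold M) W U (A : 'Hom(W, U))
    (f : M -> 'End(W)) (f' : M -> 'End(U)) (X : tangent M) (p : W) :
  smooth_at (N := vect_structure 'End(W)) f (tbase X) ->
  smooth_at (N := vect_structure 'End(U)) f' (tbase X) ->
  (forall q, A (f q p) = f' q (A p)) ->
  A (tderiv f X p) = tderiv f' X (A p).
Proof.
move=> sf sf' ff'; apply: (can_inj (@crdK R U)); apply/rowP => i.
have l_lin : linear (fun h : 'End(W) => crd (A (h p)) 0 i : R^o).
  by move=> a h k; rewrite add_lfunE scale_lfunE !linearP !mxE.
have l'_lin : linear (fun h : 'End(U) => crd (h (A p)) 0 i : R^o).
  by move=> a h k; rewrite add_lfunE scale_lfunE !linearP !mxE.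
rewrite -[LHS](tact_linear mM l_lin sf) -[RHS](tact_linear mM l'_lin sf').
by congr tact; apply/funext => q; rewrite ff'.
Qed.

End TangentMap.

(** * Coordinates and block matrices on TV *)

Section TangentBasis.
Context {R : realType} {V : vectType R} {n : nat}.
Variable alpha : n.-tuple V.
Hypothesis alphaP : basis_of {:V} alpha.

Lemma tbase_linear a (X Y : tvect V) :
  tbase (a *: X + Y) = a *: (tbase X : V) + (tbase Y : V) :> V.
Proof. by []. Qed.

Lemma tvec_linear : linear (@tvec R V).
Proof. by move=> a X Y; rewrite tvec_tadd tvec_tscale. Qed.

Lemma tbasis_lshift (i : 'I_n) :
  (tbasis alpha)`_(lshift n i) = psi_inv alpha (alpha`_i, 0).
Proof.
rewrite /tbasis /= nth_cat size_map size_enum_ord ltn_ord.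
by rewrite (nth_map i) ?size_enum_ord // nth_ord_enum.
Qed.

Lemma tbasis_rshift (i : 'I_n) :
  (tbasis alpha)`_(rshift n i) = psi_inv alpha (0, delta_mx 0 i).
Proof.
rewrite /tbasis /= nth_cat size_map size_enum_ord ltnNge leq_addr /= addKn.
by rewrite (nth_map i) ?size_enum_ord // nth_ord_enum.
Qed.

(** The second half of the basis is based at 0, so only the first half contributes. *)
Lemma tbase_tbasis_sum (k : 'I_(n + n) -> R) :
  tbase (\sum_i k i *: (tbasis alpha)`_i) = \sum_i k (lshift n i) *: alpha`_i :> V.
Proof.
pose hM := GRing.isLinear.Build _ _ _ _ (fun X : tvect V => tbase X : V) tbase_linear.
pose h : {linear tvect V -> V} := HB.pack (fun X : tvect V => tbase X : V) hM.
rewrite -[LHS]/(h _) linear_sum big_split_ord [X in _ + X = _]big1 ?addr0.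
  apply: eq_bigr => i _; rewrite tbasis_lshift linearZ.
  by congr (_ *: _); exact: tbase_tvmk.
move=> i _; rewrite tbasis_rshift linearZ -[RHS](scaler0 _ (k (rshift n i))).
by congr (_ *: _); exact: tbase_tvmk.
Qed.

Lemma tvec_tbasis_sum (k : 'I_(n + n) -> R) :
  tvec (\sum_i k i *: (tbasis alpha)`_i) = \sum_i k (rshift n i) *: alpha`_i.
Proof.
pose hM := GRing.isLinear.Build _ _ _ _ _ tvec_linear.
pose h : {linear tvect V -> V} := HB.pack (@tvec R V) hM.
rewrite -[LHS]/(h _) linear_sum big_split_ord [X in X + _ = _]big1 ?add0r.
  apply: eq_bigr => i _; rewrite linearZ /= tbasis_rshift tvec_tvmk.
  rewrite (bigD1 i) //= mxE !eqxx scale1r big1 ?addr0 // => j ji.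
  by rewrite mxE (negPf ji) andbF scale0r.
move=> i _; rewrite linearZ /= tbasis_lshift tvec_tvmk big1 ?scaler0 // => j _.
by rewrite mxE scale0r.
Qed.

(** Projecting the expansion of [Y] in [tbasis alpha] to base points gives an expansion in [alpha],
    whose coefficients are unique. *)
Lemma coord_tbasis_lshift (i : 'I_n) (Y : tvect V) :
  coord (tbasis alpha) (lshift n i) Y = coord alpha i (tbase Y : V).
Proof.
rewrite [in RHS](coord_basis (tbasisP alphaP) (memvf Y)) tbase_tbasis_sum.
by rewrite coord_sum_free // (basis_free alphaP).
Qed.

Lemma coord_tbasis_rshift (i : 'I_n) (Y : tvect V) :
  coord (tbasis alpha) (rshift n i) Y = coord alpha i (tvec Y).
Proof.
rewrite [in RHS](coord_basis (tbasisP alphaP) (memvf Y)) tvec_tbasis_sum.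
by rewrite coord_sum_free // (basis_free alphaP).
Qed.

(** With TV split into base point and vector part, a block matrix acts blockwise; this is its upper
    row. *)
Lemma tbase_mx_end_block (a b c d : 'M[R]_n) (Y : tvect V) :
  tbase (mx_end (tbasis alpha) (block_mx a b c d) Y) =
  mx_end alpha a (tbase Y : V) + mx_end alpha b (tvec Y) :> V.
Proof.
rewrite !mx_endE tbase_tbasis_sum -big_split; apply: eq_bigr => i _ /=.
rewrite big_split_ord /= -scalerDl; congr ((_ + _) *: _);
  apply: eq_bigr => j _.
  by rewrite block_mxEul coord_tbasis_lshift.
by rewrite block_mxEur coord_tbasis_rshift.
Qed.

Lemma tvec_mx_end_block (a b c d : 'M[R]_n) (Y : tvect V) :
  tvec (mx_end (tbasis alpha) (block_mx a b c d) Y) =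
  mx_end alpha c (tbase Y : V) + mx_end alpha d (tvec Y).
Proof.
rewrite !mx_endE tvec_tbasis_sum -big_split; apply: eq_bigr => i _ /=.
rewrite big_split_ord /= -scalerDl; congr ((_ + _) *: _);
  apply: eq_bigr => j _.
  by rewrite block_mxEdl coord_tbasis_lshift.
by rewrite block_mxEdr coord_tbasis_rshift.
Qed.

End TangentBasis.

(** * The tangent map of a linear map *)

Section TangentHom.
Context {R : realType} {V V' : vectType R}.
Variable A : 'Hom(V, V').

Definition tangent_hom : 'Hom(tvect V, tvect V') :=
  linfun (fun Y : tvect V => tvmk (A (tbase Y : V)) (A (tvec Y)) : tvect V').

Lemma tangent_homE (Y : tvect V) :
  tangent_hom Y = tvmk (A (tbase Y : V)) (A (tvec Y)).
Proof.
pose h (Y : tvect V) : tvect V' := tvmk (A (tbase Y : V)) (A (tvec Y)).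
have h_lin : linear h.
  move=> a X Z; apply: tvec_eq.
    rewrite [in RHS]tbase_linear /h !tbase_tvmk; exact: linearP.
  by rewrite tvec_linear /h !tvec_tvmk tvec_linear linearP.
pose hM := GRing.isLinear.Build _ _ _ _ h h_lin.
pose hL : {linear tvect V -> tvect V'} := HB.pack h hM.
exact: (lfunE hL).
Qed.

Lemma lker_tangent_hom : lker A = 0%VS -> lker tangent_hom = 0%VS.
Proof.
move/eqP/lker0P => Ainj; apply/eqP/lker0P => X Y; rewrite !tangent_homE => XY.
apply: tvec_eq; apply: Ainj.
  by have := congr1 (fun Z : tvect V' => tbase Z : V') XY; rewrite !tbase_tvmk.
by have := congr1 (@tvec R V') XY; rewrite !tvec_tvmk.
Qed.

(** Preimages are found componentwise, [A^-1] being a right inverse of the surjective [A]. *)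
Lemma limg_tangent_hom : limg A = fullv -> limg tangent_hom = fullv.
Proof.
move=> Asurj; apply/eqP; rewrite eqEsubv subvf /=; apply/subvP => Y _.
have AK y : A (A^-1%VF y) = y by apply: limg_lfunVK; rewrite Asurj memvf.
apply/memv_imgP; exists (tvmk (A^-1%VF (tbase Y : V')) (A^-1%VF (tvec Y))).
  exact: memvf.
rewrite tangent_homE; apply: tvec_eq; first by rewrite !tbase_tvmk AK.
by rewrite !tvec_tvmk AK.
Qed.

End TangentHom.

(** * Block form of the prolongation and the representation property *)

Section Prolongation.
Context {R : realType}.

(** Right multiplication by a^-1 is linear in the matrix, so B = D a^-1 with D the derivative of the
    inclusion into all matrices. Hence the lower-left block of [Jn] is D itself. *)
Lemma right_trivialization_tderiv n (X : tangent (gl_structure R n)) :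
  right_trivialization X *m val (tbase X) =
  tderiv (fun a : gl_structure R n => val a) X.
Proof.
have mG := gl_manifold R n.
have sv p := val_smooth_at p (@gl_open R n).
set a := val (tbase X); set D := tderiv _ X.
suff -> : right_trivialization X = D *m invmx a.
  by rewrite mulmxKV //; exact: valP.
apply/matrixP => i j; rewrite mxE.
have l_lin b : linear (fun y : 'M[R]_n => (y *m b) i j : R^o).
  by move=> k x y; rewrite mulmxDl -scalemxAl !mxE.
have l1_lin : linear (fun y : 'M[R]_n => y i j : R^o).
  by move=> k x y; rewrite !mxE.
rewrite /= /tmap_act asboolT; last exact: (smooth_fun_at_linear l1_lin (sv _)).
exact: (tact_linear mG (l_lin (invmx a)) (sv _)).
Qed.

Variables (G : lie_data R) (hG : is_lie_group G) (V : vectType R).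
Variables (n : nat) (alpha : n.-tuple V) (alphaP : basis_of {:V} alpha).
Variables (Phi : G -> aut_lie V) (hPhi : is_representation Phi).

Let f (g : G) : 'End(V) := val (Phi g).

Lemma representation_End_smooth : smooth (N := vect_structure 'End(V)) f.
Proof.
move=> g; apply: (smooth_at_comp (aut_manifold V) (proj1 hPhi g)).
exact: (val_smooth_at _ (@aut_open R V)).
Qed.

(** The chain rule through [TZ] and [TPhi] turns the lower-left block of [Jn] into the derivative of
    the matrix of [f], and the linear map [end_mx] comes out of it. *)
Lemma val_prolongation (X : tangent_lie hG) :
  val (prolongation hG alphaP hPhi X) =
  mx_end (tbasis alpha)
    (block_mx (end_mx alpha (f (tbase X))) 0
              (end_mx alpha (tderiv f X)) (end_mx alpha (f (tbase X)))).
Proof.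
rewrite /prolongation /=; congr (mx_end _ (block_mx _ _ _ _)).
set Y := tmap _ _ _ _.
rewrite -[X in _ *m X]/(val (tbase Y)) right_trivialization_tderiv.
rewrite tderiv_tmap; last exact: (val_smooth_at _ (@gl_open R n)).
rewrite -(tderiv_linear (lie_manifold hG) (end_mx alpha)); last first.
  exact: representation_End_smooth.
rewrite tderiv_tmap //.
apply: (smooth_at_comp (gl_manifold R n) (aut_mx_smooth alphaP _)).
exact: (val_smooth_at _ (@gl_open R n)).
Qed.

Lemma prolongation_smooth : smooth (prolongation hG alphaP hPhi).
Proof.
(* [B1] and [B2] split the block matrix into its dependence on f and on f_X. *)
pose B1 (h : 'End(V)) := mx_end (tbasis alpha)
  (block_mx (end_mx alpha h) 0 0 (end_mx alpha h)).
pose B2 (h : 'End(V)) := mx_end (tbasis alpha) (block_mx 0 0 (end_mx alpha h) 0).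
have tP := tbasisP alphaP.
have B1_lin : linear B1.
  move=> a h k; apply: (can_inj (end_mxK tP)); rewrite [RHS]linearP /B1 /= !mx_endK //.
  by rewrite linearP /= scale_block_mx add_block_mx !scaler0 addr0.
have B2_lin : linear B2.
  move=> a h k; apply: (can_inj (end_mxK tP)); rewrite [RHS]linearP /B2 /= !mx_endK //.
  by rewrite linearP /= scale_block_mx add_block_mx !scaler0 addr0.
pose M1 := GRing.isLinear.Build _ _ _ _ B1 B1_lin.
pose L1 : {linear 'End(V) -> 'End(tvect V)} := HB.pack B1 M1.
pose M2 := GRing.isLinear.Build _ _ _ _ B2 B2_lin.
pose L2 : {linear 'End(V) -> 'End(tvect V)} := HB.pack B2 M2.
apply: (@smooth_tderiv_linear R G (lie_manifold hG) _ _ _ f _ L1 L2).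
  exact: representation_End_smooth.
move=> X; rewrite val_prolongation; apply: (can_inj (end_mxK tP)).
rewrite [RHS]linearD /= !mx_endK // add_block_mx.
by rewrite !addr0 add0r.
Qed.

Lemma prolongation_representation : is_representation (prolongation hG alphaP hPhi).
Proof.
split; first exact: prolongation_smooth.
have fM a b : f (lmul a b) = (f a \o f b)%VF by rewrite /f (proj2 hPhi).
move=> X Y; apply: val_inj.
rewrite -[RHS]/(val (prolongation hG alphaP hPhi X) \o
                val (prolongation hG alphaP hPhi Y))%VF !val_prolongation.
rewrite -mx_end_mul; last exact: tbasisP.
(* The lower-left block of the product is the right-hand side of [tderiv_lmul]. *)
rewrite mulmx_block !mul0mx !mulmx0 !addr0 add0r tbase_lmul fM.
rewrite tderiv_lmul //; first by rewrite linearD /= !end_mx_comp.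
exact: representation_End_smooth.
Qed.

Lemma tbase_prolongation (X : tangent_lie hG) (Y : tvect V) :
  tbase (val (prolongation hG alphaP hPhi X) Y) = f (tbase X) (tbase Y) :> V.
Proof.
rewrite val_prolongation tbase_mx_end_block // end_mxK // mx_endE.
by rewrite big1 ?addr0 // => i _; rewrite big1 ?scale0r // => j _; rewrite mxE mul0r.
Qed.

Lemma tvec_prolongation (X : tangent_lie hG) (Y : tvect V) :
  tvec (val (prolongation hG alphaP hPhi X) Y) =
  tderiv f X (tbase Y : V) + f (tbase X) (tvec Y).
Proof. by rewrite val_prolongation tvec_mx_end_block // !end_mxK. Qed.

End Prolongation.

(** * Equivalence of the prolongations *)

Theorem proposition3p8 (R : realType) (G : lie_data R) (hG : is_lie_group G)
    (V V' : vectType R)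
    (n : nat) (alpha : n.-tuple V) (alphaP : basis_of {:V} alpha)
    (n' : nat) (alpha' : n'.-tuple V') (alphaP' : basis_of {:V'} alpha')
    (Phi : G -> aut_lie V) (hPhi : is_representation Phi)
    (Phi' : G -> aut_lie V') (hPhi' : is_representation Phi') :
  equivalent_representations Phi Phi' ->
  [/\ is_representation (prolongation hG alphaP hPhi),
      is_representation (prolongation hG alphaP' hPhi') &
      equivalent_representations (prolongation hG alphaP hPhi)
                                 (prolongation hG alphaP' hPhi')].
Proof.
move=> [A [Aker Aimg AE]]; split; try exact: prolongation_representation.
exists (tangent_hom A); split.
- exact: lker_tangent_hom.
- exact: limg_tangent_hom.
- move=> X Y; rewrite !tangent_homE; apply: tvec_eq.
    by rewrite !(tbase_tvmk, tbase_prolongation) AE.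
  rewrite [LHS]tvec_tvmk !tvec_prolongation tbase_tvmk tvec_tvmk linearD.
  (* The term with f at the base point is intertwined by [AE] itself, the term with f_X by
     differentiating [AE]. *)
  congr (_ + _); last exact: AE.
  apply: (tderiv_intertwine (lie_manifold hG)).
  - exact: representation_End_smooth.
  - exact: representation_End_smooth.
  - by move=> q; exact: AE.
Qed.
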